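(* Let $\nu>\frac32$. Then for all $x>0$ and $\tau>0$, $$|K_{i\tau}(x)|\le 2^{\nu-2}\,c_\nu\,\frac{\Gamma\left(\frac{\nu+3/2}{2}\right)\Gamma\left(\frac{\nu-3/2}{2}\right)}{\tau\,\Gamma(\nu)}\,\bigl|\Gamma(\nu+i\tau)\bigr|\,x^{3/2-\nu},$$ where $c_\nu=\sup_{t\ge0}\sqrt t\,|J_\nu(t)|$.
   Context: $K_{i\tau}(x)=\int_0^\infty e^{-x\cosh t}\cos(\tau t)\,dt$ ($x>0$) is the Macdonald function (modified Bessel function of the second kind) of imaginary index; $J_\nu$ is the Bessel function of the first kind; $\Gamma$ is the Euler gamma function. *)

(* Defs.v *)
From HB Require Import structures.
From mathcomp Require Export all_boot all_order all_algebra.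
From mathcomp Require Export all_classical all_reals all_analysis.
From mathcomp Require Export complex.

Set Implicit Arguments.
Unset Strict Implicit.
Unset Printing Implicit Defensive.

Import Order.TTheory GRing.Theory Num.Theory.
Import numFieldNormedType.Exports.

Local Open Scope classical_set_scope.
Local Open Scope ring_scope.
Local Open Scope complex_scope.

Definition cosh (R : realType) (t : R) : R := (expR t + expR (- t)) / 2.

(* The integrand is absolutely integrable for x > 0, so the Lebesgue integral
   agrees with the improper Riemann integral. *)
Definition macdonaldK_im (R : realType) (tau x : R) : R :=
  \int[@lebesgue_measure R]_(t in `[0, +oo[) (expR (- x * cosh t) * cos (tau * t)).

(* t ^ z = exp (z ln t), meaningful for t > 0 *)
Definition cpow (R : realType) (t : R) (z : R[i]) : R[i] :=
  (t `^ complex.Re z * cos (complex.Im z * ln t))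
  +i* (t `^ complex.Re z * sin (complex.Im z * ln t)).

(* Euler's integral of t ^ (z - 1) * exp (- t), taken componentwise;
   this is the gamma function on the half-plane Re z > 0. *)
Definition GammaC (R : realType) (z : R[i]) : R[i] :=
  let f t := cpow t (z - 1) * (expR (- t))%:C in
  (\int[@lebesgue_measure R]_(t in `]0, +oo[) complex.Re (f t))
  +i* (\int[@lebesgue_measure R]_(t in `]0, +oo[) complex.Im (f t)).

(* Real gamma function, for a > 0 *)
Definition Gamma (R : realType) (a : R) : R :=
  \int[@lebesgue_measure R]_(t in `]0, +oo[) (t `^ (a - 1) * expR (- t)).

Lemma GammaC_real (R : realType) (a : R) : GammaC a%:C = (Gamma a)%:C.
Proof.
rewrite /GammaC /Gamma /cpow /=; congr (_ +i* _).
  by apply: eq_Rintegral => t _; rewrite oppr0 addr0 mul0r cos0 mulr1 mulr0 subr0.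
rewrite (_ : (fun t : R => _) = cst 0); first by rewrite /Rintegral integral0.
by apply/funext => t; rewrite oppr0 addr0 mul0r sin0 !mulr0 mul0r addr0.
Qed.

(* Power series of J_nu, for nu > -1 and t >= 0 (so that the arguments of
   Gamma are positive and t / 2 has a real power nu). *)
Definition besselJ (R : realType) (nu t : R) : R :=
  limn (series (fun k : nat =>
    (-1) ^+ k / (k`!%:R * Gamma (k%:R + nu + 1))
    * (t / 2) `^ (2 * k%:R + nu))).

(* sup is real-valued: it is the genuine supremum because the set is bounded
   for nu >= -1/2. *)
Definition besselJ_const (R : realType) (nu : R) : R :=
  sup [set Num.sqrt t * `|besselJ nu t| | t in [set t : R | 0 <= t]].

(* Main.v *)
(* Weber's integral gives the Laplace transform of psi s = J_nu (x sqrt s) s ^ (nu / 2),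
   namely (x / 2) ^ nu t ^ (- nu - 1) exp (- x ^ 2 / (4 t)).  Pair it with
   phi t = t ^ (nu - 1) exp (- t) sin (tau ln (2 t / x)).  After t = (x / 2) exp u the
   pairing is a multiple of the integral of exp (- u - x cosh u) sin (tau u) over the
   real line, that is of K_(1 - i tau) - K_(1 + i tau) = - (2 i tau / x) K_(i tau); the
   last equality is an integration by parts.  By Fubini the pairing is also the
   integral of psi s against the Laplace transform of phi at s, which is bounded by
   |Gamma (nu + i tau)| (1 + s) ^ (- nu); with
   |psi s| <= c_nu x ^ (- 1/2) s ^ (nu / 2 - 1/4) the remaining integral is a Beta
   integral.  That c_nu is a genuine supremum follows from the monotonicity of
   u ^ 2 + u' ^ 2 / (1 - (nu ^ 2 - 1/4) / t ^ 2) for u = sqrt t J_nu t and large t. *)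

Require Import Defs.
From mathcomp Require Import all_boot all_order all_algebra.
From mathcomp Require Import all_classical all_reals all_analysis.
From mathcomp Require Import complex.
From mathcomp Require Import measurable_realfun ring lra.

Set Implicit Arguments.
Unset Strict Implicit.
Unset Printing Implicit Defensive.

Import Order.TTheory GRing.Theory Num.Theory.
Import numFieldNormedType.Exports.

Local Open Scope ring_scope.

(** * Scaling and exhaustion for integrals over the half-line *)

Section IntegralTools.
Local Open Scope classical_set_scope.

(** The condition [3 / 2 < nu] is a convergence condition: psi s is at most a multiple of s ^ (b -
    1) with b = nu / 2 + 3 / 4, and s ^ (b - 1) (1 + s) ^ (- nu) is integrable at infinity exactly
    when b < nu. The value Gamma b * Gamma (nu - b) / Gamma nu of that Beta integral is not computed
    head-on: the symmetry of the Laplace transform is applied a second time, to the model pair t ^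
    (nu - 1) exp (- t) and s ^ (b - 1), whose transforms are explicit. The same pair dominates the
    oscillating one and so justifies Fubini. The transform of phi is controlled by the modulus of
    one Gamma value because rescaling t by 1 + s multiplies t ^ (i tau) by a number of modulus 1,
    which merely moves the phase of the sine; hence a bound uniform in the phase is proved. On the
    Bessel side everything goes through the entire function g with J_nu t = (t / 2) ^ nu g (t ^ 2 /
    4). In the variable z = t ^ 2 / 4 the differential equation has no square roots, and the same
    series is integrated termwise for Weber's formula. *)

Lemma measurable_itvR (R : realType) (i : interval R) :
  measurable ([set` i] : set (measurableTypeR R)).
Proof. exact: measurable_itv. Qed.

(** Lebesgue measure is determined by its values on half-open intervals, so only the length of []a /
    c, b / c]] has to be compared with that of []a, b]]. *)
Lemma pushforward_lebesgue_scale (R : realType) (c : R) (hc : 0 < c)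
    (A : set (measurableTypeR R)) : measurable A ->
  (c%:E * pushforward (@lebesgue_measure R)
     ( *%R c : measurableTypeR R -> measurableTypeR R) A =
  @lebesgue_measure R A)%E.
Proof.
move=> mA; apply/esym.
have mc : measurable_fun [set: measurableTypeR R]
    ( *%R c : measurableTypeR R -> measurableTypeR R).
  exact: mulrl_measurable.
pose ph := measure_function_pushforward__canonical__measure_function_Measure (@lebesgue_measure R) mc.
apply: (@lebesgue_measure_unique R (mscale (NngNum (ltW hc)) ph)) => // _ [[a b] _ <-].
rewrite -[RHS]/(c%:E * @lebesgue_measure R ( *%R c @^-1` `]a, b]))%E.
have -> : *%R c @^-1` `]a, b] = `]a / c, b / c].
  by apply/seteqP; split => x; rewrite /= !in_itv /= ltr_pdivrMr// ler_pdivlMr// mulrC.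
rewrite !lebesgue_measure_itv /= !lte_fin ltr_pM2r ?invr_gt0//.
case: ifPn => _; last by rewrite mule0.
by rewrite -!EFinB -EFinM; congr EFin; field; rewrite gt_eqF.
Qed.

(** The version for nonnegative extended-real functions asks for no integrability, so it can be used
    to prove that rescaling preserves it. *)
Lemma ge0_integral_scale (R : realType) (c : R) (f : R -> \bar R) : 0 < c ->
  measurable_fun `](0:R), +oo[ f -> (forall x, 0 < x -> (0 <= f x)%E) ->
  (c%:E * \int[@lebesgue_measure R]_(x in `]0%R, +oo[) f (c * x)%R =
   \int[@lebesgue_measure R]_(x in `]0%R, +oo[) f x)%E.
Proof.
move=> hc mf f0.
have mc : measurable_fun [set: measurableTypeR R]
    ( *%R c : measurableTypeR R -> measurableTypeR R).
  exact: mulrl_measurable.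
have f0' : {in `]0, +oo[%classic, forall y : R, (0 <= f y)%E}.
  by move=> y; rewrite inE/= in_itv/= andbT; exact: f0.
have pE : ( *%R c @^-1` `]0, +oo[)%classic = `]0, +oo[%classic :> set R.
  by apply/seteqP; split => x /=; rewrite !in_itv/= !andbT pmulr_rgt0.
rewrite -{1}pE -(@ge0_integral_pushforward _ _ _ _ R _ mc)//.
rewrite -[c]/(NngNum (ltW hc))%:num -ge0_integral_mscale//; last first.
  by move=> x; rewrite /= in_itv/= andbT; exact: f0.
by apply: eq_measure_integral => A mA _; exact: pushforward_lebesgue_scale.
Qed.

Lemma measurable_fun_scale (R : realType) (c : R) (f : R -> \bar R) : 0 < c ->
  measurable_fun `](0:R), +oo[ f -> measurable_fun `](0:R), +oo[ (fun x => f (c * x)).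
Proof.
move=> hc mf.
rewrite -[X in measurable_fun _ X]/(f \o *%R c).
apply: (@measurable_comp _ _ _ _ _ _ `](0 : R), +oo[%classic) => //.
  by move=> _ [x + <-]; rewrite /= !in_itv/= !andbT => x0; rewrite mulr_gt0.
Qed.

Lemma integrable_scale (R : realType) (c : R) (f : R -> \bar R) : 0 < c ->
  (@lebesgue_measure R).-integrable `](0:R), +oo[ f ->
  (@lebesgue_measure R).-integrable `](0:R), +oo[ (fun x => f (c * x)).
Proof.
move=> hc /integrableP[mf If]; apply/integrableP.
split; first exact: measurable_fun_scale.
have ma : measurable_fun `](0:R), +oo[ (fun x => `|f x|%E) by exact: measurableT_comp.
have E := ge0_integral_scale hc ma (fun x _ => abse_ge0 _).
move: If; rewrite -E; set I := integral _ _ _.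
have : (0 <= I)%E by apply: integral_ge0.
case: I => [r| |] //= _; first by rewrite !ltry.
by rewrite gt0_muley ?lte_fin.
Qed.

Lemma Rintegral_scale (R : realType) (c : R) (f : R -> R) : 0 < c ->
  (@lebesgue_measure R).-integrable `](0:R), +oo[ (EFin \o f) ->
  c * \int[@lebesgue_measure R]_(x in `]0, +oo[) f (c * x) =
  \int[@lebesgue_measure R]_(x in `]0, +oo[) f x.
Proof.
move=> hc iF.
have mF := measurable_int _ iF.
have ic := integrable_scale hc iF.
apply: EFin_inj; rewrite EFinM /Rintegral !fineK//; last 2 first.
- exact: integrable_fin_num iF.
- exact: integrable_fin_num ic.
rewrite integralE [in RHS]integralE.
have Ep := @ge0_integral_scale R c ((EFin \o f)^\+)%E hc (measurable_funepos mF) (fun x _ => funepos_ge0 _ _).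
have En := @ge0_integral_scale R c ((EFin \o f)^\-)%E hc (measurable_funeneg mF) (fun x _ => funeneg_ge0 _ _).
rewrite -Ep -En muleBr//; last first.
  apply: fin_num_adde_defl; rewrite fin_numN.
  by apply: integrable_neg_fin_num; [exact: measurable_itv|exact: ic].
by congr (_ * _ - _ * _)%E; apply: eq_integral => x _; rewrite ?funeposE ?funenegE.
Qed.

(** Dominated convergence for the restrictions of [f] to [S n], with [|f|] as dominating function.
    The sets may grow in any manner as long as each point is eventually covered. *)
Lemma cvg_Rintegral_subset (R : realType) (D : set (measurableTypeR R))
    (S : nat -> set (measurableTypeR R)) (f : R -> R) :
  measurable D -> (forall n, measurable (S n)) -> (forall n, S n `<=` D) ->
  (forall x, D x -> \forall n \near \oo, S n x) ->
  (@lebesgue_measure R).-integrable D (EFin \o f) ->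
  \int[@lebesgue_measure R]_(x in S n) f x @[n --> \oo] -->
  \int[@lebesgue_measure R]_(x in D) f x.
Proof.
move=> mD mS SD cS iF.
have mF := measurable_int _ iF.
have iS n : (@lebesgue_measure R).-integrable (S n) (EFin \o f).
  exact: integrableS iF.
pose f_ n := (EFin \o f) \_ (S n).
have ig : (@lebesgue_measure R).-integrable D (abse \o (EFin \o f)) by exact: integrable_abse.
have mf_ n : measurable_fun D (f_ n).
  apply/(measurable_restrict _ (mS n) mD).
  by rewrite setIidr//; exact: measurable_int (iS n).
have f_f : {ae @lebesgue_measure R, forall x, D x -> f_ ^~ x @ \oo --> (EFin \o f) x}.
  apply: aeW => x Dx; apply: cvg_near_cst.
  by apply: filterS (cS x Dx) => n Sn; rewrite /f_ patchE mem_set.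
have f_g : {ae @lebesgue_measure R, forall x n, D x -> (`|f_ n x| <= (abse \o (EFin \o f)) x)%E}.
  apply: aeW => x n Dx; rewrite /f_ patchE; case: ifP => //= _.
  by rewrite normr0 lee_fin.
have [_ _] := dominated_convergence mD mf_ mF f_f ig f_g.
have -> : (fun n => \int[@lebesgue_measure R]_(x in D) f_ n x)%E =
   (fun n => \int[@lebesgue_measure R]_(x in S n) (f x)%:E)%E.
  apply/funext => n; rewrite /f_.
  rewrite (integral_mkcond (S n)) (integral_mkcond D) -patch_setI.
  by rewrite setIidr.
move=> H; apply: fine_cvg; rewrite /Rintegral fineK //.
exact: integrable_fin_num iF.
Qed.

Lemma cvg_Rintegral_itv_pos (R : realType) (a b : nat -> R) (f : R -> R) :
  (forall n, 0 < a n) -> a @ \oo --> 0 -> b @ \oo --> +oo ->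
  (@lebesgue_measure R).-integrable `](0:R), +oo[ (EFin \o f) ->
  \int[@lebesgue_measure R]_(x in `[a n, b n]) f x @[n --> \oo] -->
  \int[@lebesgue_measure R]_(x in `]0, +oo[) f x.
Proof.
move=> a0 ca cb; apply: cvg_Rintegral_subset => //.
  move=> n x /=; rewrite !in_itv/= andbT => /andP[anx _].
  exact: lt_le_trans anx.
move=> x /=; rewrite in_itv/= andbT => x0.
near=> n; rewrite /= in_itv/=; apply/andP; split.
  near: n; exact: (cvgr_le _ ca).
by near: n; move/cvgryPge : cb; apply.
Unshelve. all: by end_near. Qed.

End IntegralTools.

(** * The real Gamma function: convergence, positivity, recurrence *)

Section GammaFacts.
Local Open Scope classical_set_scope.

Lemma is_derive_continuous (R : realType) (f : R -> R) (x d : R) :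
  is_derive x 1 f d -> {for x, continuous f}.
Proof.
move=> [df _]; exact/differentiable_continuous/derivable1_diffP.
Qed.

Lemma is_derive_FTC2 (R : realType) (F f : R -> R) (a b : R) : a < b ->
  (forall t, a <= t <= b -> is_derive t 1 F (f t)) ->
  (forall t, a <= t <= b -> {for t, continuous f}) ->
  (\int[@lebesgue_measure R]_(t in `[a, b]) (f t)%:E = (F b - F a)%:E)%E.
Proof.
move=> ab dF cf; rewrite EFinB; apply: continuous_FTC2 => //.
- apply: continuous_in_subspaceT => t; rewrite inE/= in_itv/=; exact: cf.
- split.
  + by move=> t /[!in_itv]/= /andP[/ltW at_ /ltW tb]; apply: ex_derive; apply: dF; rewrite at_.
  + apply: cvg_at_right_filter; apply: is_derive_continuous (dF _ _).
    by rewrite lexx ltW.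
  + apply: cvg_at_left_filter; apply: is_derive_continuous (dF _ _).
    by rewrite lexx ltW.
- move=> t /[!in_itv]/= /andP[/ltW at_ /ltW tb].
  by rewrite derive1E; apply: derive_val; apply: dF; rewrite at_.
Qed.

Lemma measurable_powR_expR (R : realType) (a c : R) (D : set R) :
  measurable_fun D (fun t : R => t `^ a * expR (- (c * t))).
Proof.
apply: measurable_funTS; apply: measurable_funM; first exact: measurable_powR.
apply: measurableT_comp; first exact: measurable_expR.
by apply: measurable_funN; exact: mulrl_measurable.
Qed.

Lemma measurable_powR_expRN (R : realType) (a : R) (D : set R) :
  measurable_fun D (fun t : R => t `^ a * expR (- t)).
Proof.
apply: measurable_funTS; apply: measurable_funM; first exact: measurable_powR.
by apply: measurableT_comp; [exact: measurable_expR|exact: measurable_funN].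
Qed.

Lemma is_derive_powR1D (R : realType) (a t : R) : 0 < 1 + t ->
  is_derive t 1 (fun t : R => (1 + t) `^ a) (a * (1 + t) `^ (a - 1)).
Proof.
move=> t1; have dD : is_derive t 1 (fun t : R => 1 + t) 1.
  by have := is_deriveD (is_derive_cst (1 : R) t 1) (is_derive_id t 1); rewrite add0r.
by have := is_derive1_comp (is_derive1_powR a t1) dD; rewrite mulr1.
Qed.

Lemma exists_invn_itv (R : realType) (t : R) : 0 < t ->
  exists n : nat, n.+2%:R^-1 <= t <= n.+2%:R.
Proof.
move=> t0; pose n := Num.bound (t + t^-1); exists n.
have ti : 0 < t^-1 by rewrite invr_gt0.
have tn : t + t^-1 < n.+2%:R.
  have : t + t^-1 < n%:R by apply: archi_boundP; rewrite ltW// addr_gt0.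
  by move/lt_trans; apply; rewrite ltr_nat.
apply/andP; split; last by lra.
by rewrite -[leRHS]invrK lef_pV2 ?posrE//; lra.
Qed.

(** This is the [p]-th power of 1 + t <= p (1 + t / p) <= p exp (t / p); the first inequality uses
    [1 <= p]. *)
Lemma powR1D_le_expR (R : realType) (p t : R) : 1 <= p -> 0 <= t ->
  (1 + t) `^ p <= p `^ p * expR t.
Proof.
move=> p1 t0; have p0 : 0 < p by lra.
have -> : expR t = (expR (t / p)) `^ p by rewrite -expRM divfK ?gt_eqF.
rewrite -powRM ?expR_ge0 ?(ltW p0)// ge0_ler_powR ?nnegrE ?mulr_ge0 ?expR_ge0 ?(ltW p0) ?addr_ge0//.
have /(ler_wpM2l (ltW p0)) := expR_ge1Dx (t / p).
by apply: le_trans; rewrite mulrDr mulr1 mulrCA divff ?gt_eqF// mulr1; lra.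
Qed.

(* The dominating function is a multiple of the derivative of the bounded
   function (t / (1 + t)) ^ a. *)
Lemma integrable_powR_expRN (R : realType) (a : R) : 0 < a ->
  (@lebesgue_measure R).-integrable `](0:R), +oo[
    (EFin \o (fun t => t `^ (a - 1) * expR (- t))).
Proof.
move=> a0.
pose g (t : R) := t `^ (a - 1) * (1 + t) `^ (- a - 1).
pose F (t : R) := a^-1 * (t `^ a * (1 + t) `^ (- a)).
have dF (t : R) : 0 < t -> is_derive t 1 F (g t).
  move=> t0; have t1 : 0 < 1 + t by rewrite addr_gt0.
  have d1 := is_derive_powR1D (- a) t1.
  have d2 := is_derive1_powR a t0.
  apply: is_derive_eq.
  rewrite /g /GRing.scale /=.
  have -> : t `^ a = t * t `^ (a - 1) by rewrite mulr_powRB1// ltW.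
  have -> : (1 + t) `^ (- a) = (1 + t) * (1 + t) `^ (- a - 1).
    rewrite -{2}(powRr1 (ltW t1)) -powRD; last by rewrite (gt_eqF t1) implybT.
    by congr powR; lra.
  by field; rewrite gt_eqF.
have g0 (t : R) : 0 <= g t by rewrite mulr_ge0// powR_ge0.
have cg (t : R) : 0 < t -> {for t, continuous g}.
  move=> t0; have t1 : 0 < 1 + t by rewrite addr_gt0.
  apply: cvgM; first exact: is_derive_continuous (is_derive1_powR _ t0).
  exact: is_derive_continuous (is_derive_powR1D _ t1).
have F1 (t : R) : 0 < t -> 0 <= F t <= a^-1.
  move=> t0; have t1 : 0 < 1 + t by rewrite addr_gt0.
  have ai : 0 <= a^-1 by rewrite invr_ge0 ltW.
  apply/andP; split; first by rewrite !mulr_ge0// powR_ge0.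
  rewrite /F ler_piMr// powRN ler_pdivrMr ?powR_gt0// mul1r.
  by rewrite ge0_ler_powR ?nnegrE ?(ltW a0) ?(ltW t0) ?(ltW t1)// lerDr.
have bnd (t : R) : 0 < t -> t `^ (a - 1) * expR (- t) <= (a + 1) `^ (a + 1) * g t.
  move=> t0; have t1 : 0 < 1 + t by rewrite addr_gt0.
  rewrite mulrCA ler_wpM2l ?powR_ge0// (_ : - a - 1 = - (a + 1)); last by lra.
  rewrite powRN ler_pdivlMr ?powR_gt0// expRN mulrC ler_pdivrMr ?expR_gt0//.
  by apply: powR1D_le_expR; lra.
have mg : measurable_fun [set: R] g.
  apply: measurable_funM; first exact: measurable_powR.
  have m1 : measurable_fun [set: R] (fun t : R => 1 + t).
    by apply: measurable_funD.
  exact: (measurableT_comp (measurable_powR _) m1).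
have Ig : (\int[@lebesgue_measure R]_(t in `]0%R, +oo[) (g t)%:E <= (a^-1)%:E)%E.
  (* Starting at 2 keeps the lower end strictly below the upper one for every [n], as the
     fundamental theorem of calculus requires. *)
  pose S (n : nat) : set (measurableTypeR R) := `[n.+2%:R^-1, n.+2%:R].
  have -> : `]0%R, +oo[%classic = \bigcup_n S n.
    apply/seteqP; split => [t|t [n _]] /=; rewrite /S /= !in_itv/= ?andbT; last first.
      by move=> /andP[+ _]; apply: lt_le_trans; rewrite invr_gt0.
    by move=> /exists_invn_itv[n tn]; exists n => //=; rewrite in_itv.
  have cI : (\int[@lebesgue_measure R]_(t in S n) (g t)%:E @[n --> \oo] -->
      \int[@lebesgue_measure R]_(t in \bigcup_n S n) (g t)%:E)%E.
    apply: ge0_nondecreasing_set_cvg_integral.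
    - apply/nondecreasing_seqP => n; rewrite subsetEset => t; rewrite /S /= !in_itv/=.
      move=> /andP[nt tn]; apply/andP; split; last by rewrite (le_trans tn)// ler_nat.
      by apply: le_trans nt; rewrite lef_pV2 ?posrE// ler_nat.
    - by move=> n; exact: measurable_itv.
    - by move=> n; apply/measurable_EFinP; exact: measurable_funTS.
    - by move=> n t _; rewrite lee_fin.
  apply: (cvge_to_le cI); apply: nearW => n.
    have n0 : 0 < n.+2%:R^-1 :> R by rewrite invr_gt0.
    have St (t : R) : n.+2%:R^-1 <= t <= n.+2%:R -> 0 < t.
      by move=> /andP[+ _]; exact: lt_le_trans.
    have n1 : n.+2%:R^-1 < n.+2%:R :> R.
      by rewrite (@lt_trans _ _ 1)// ?ltr1n// invf_lt1// ltr1n.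
    rewrite (is_derive_FTC2 n1 (fun t h => dF t (St t h)) (fun t h => cg t (St t h))).
    rewrite lee_fin; have /andP[_ u] := F1 n.+2%:R (ltr0Sn _ _).
    have /andP[l _] := F1 _ n0; lra.
have ig : (@lebesgue_measure R).-integrable `](0:R), +oo[ (EFin \o g).
  apply/integrableP; split; first by apply/measurable_EFinP; exact: measurable_funTS.
  under eq_integral do rewrite gee0_abs ?lee_fin//.
  exact: le_lt_trans Ig (ltry _).
have iCg := integrableZl (measurable_itvR _) ((a + 1) `^ (a + 1)) ig.
apply: le_integrable iCg => //.
  by apply/measurable_EFinP; exact: measurable_powR_expRN.
move=> t; rewrite /= in_itv/= andbT => t0.
rewrite lee_fin !normrM !(ger0_norm (powR_ge0 _ _)) ger0_norm ?expR_ge0//.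
exact: bnd.
Qed.

Lemma integral_Gamma (R : realType) (a : R) : 0 < a ->
  (\int[@lebesgue_measure R]_(t in `]0%R, +oo[) (t `^ (a - 1) * expR (- t))%:E
   = (Gamma a)%:E)%E.
Proof.
move=> a0; rewrite /Gamma /Rintegral fineK//.
by apply: integrable_fin_num (integrable_powR_expRN a0).
Qed.

Lemma Gamma_gt0 (R : realType) (a : R) : 0 < a -> 0 < Gamma a.
Proof.
move=> a0; rewrite -lte_fin -integral_Gamma//.
have mf : measurable_fun `](0:R), +oo[ (fun t => (t `^ (a - 1) * expR (- t))%:E).
  by apply/measurable_EFinP; exact: measurable_powR_expRN.
have f0 (t : R) : (0 <= (t `^ (a - 1) * expR (- t))%:E)%E.
  by rewrite lee_fin mulr_ge0 ?powR_ge0 ?expR_ge0.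
have s12 : `[1, 2] `<=` `](0:R), +oo[.
  by move=> t; rewrite /= !in_itv/= andbT => /andP[+ _]; exact: lt_le_trans.
(* On [1, 2] the integrand is t ^ a / t * exp (- t) with t ^ a >= 1, hence at least exp (- 2) / 2,
   whatever the sign of a - 1. *)
apply: (@lt_le_trans _ _ (\int[@lebesgue_measure R]_(t in `[1%R, 2%R]) (expR (- 2) / 2)%:E)%E).
  rewrite integral_cst.
  2: exact: measurable_itvR.
  rewrite /= lebesgue_measure_itv/= lte_fin ltr1n -EFinB -EFinM lte_fin.
  by rewrite mulr_gt0 ?divr_gt0 ?expR_gt0// subr_gt0 ltr1n.
apply: (@le_trans _ _ (\int[@lebesgue_measure R]_(t in `[1%R, 2%R]) (t `^ (a - 1) * expR (- t))%:E)%E).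
  apply: ge0_le_integral => //.
  - exact: (measurable_funS _ s12 mf).
  - move=> t; rewrite /= in_itv/= => /andP[t1 t2]; rewrite lee_fin mulrC.
    have t0 : 0 < t by exact: lt_le_trans t1.
    rewrite ler_pM ?invr_ge0 ?expR_ge0//; last by rewrite ler_expR lerN2.
    rewrite powRB; last by rewrite (gt_eqF t0) implybT.
    rewrite powRr1 ?(ltW t0)// -[leLHS]mul1r ler_pM ?invr_ge0//.
      have <- : 1 `^ a = 1 by rewrite powR1.
      by rewrite ge0_ler_powR ?nnegrE ?(ltW a0) ?(ltW t0).
    by rewrite lef_pV2 ?posrE.
by apply: ge0_subset_integral.
Qed.

Lemma cvg_natrS2y (R : realType) : (fun n => n.+2%:R : R) @ \oo --> +oo.
Proof.
apply/cvgryPge => A; exists (Num.bound `|A|) => // n /= hn.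
apply: le_trans (ler_norm A) _; apply: le_trans (ltW (archi_boundP (normr_ge0 A))) _.
by rewrite ler_nat (leq_trans hn)// -addn2 leq_addr.
Qed.

(** The integral of [f] is [a * Gamma a - Gamma (a + 1)] by linearity, and it is 0 because [f] is
    the derivative of t ^ a exp (- t), which vanishes at both ends of the half-line. *)
Lemma Gamma_rec (R : realType) (a : R) : 0 < a -> Gamma (a + 1) = a * Gamma a.
Proof.
move=> a0; have a1 : 0 < a + 1 by rewrite addr_gt0.
have i0 := integrable_powR_expRN a0; have i1 := integrable_powR_expRN a1.
rewrite addrK in i1.
have i0' := integrableZl (measurable_itvR _) a i0.
pose f (t : R) := a * (t `^ (a - 1) * expR (- t)) - t `^ a * expR (- t).
pose F (t : R) := t `^ a * expR (- t).
have If : \int[@lebesgue_measure R]_(t in `]0, +oo[) f t = a * Gamma a - Gamma (a + 1).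
  rewrite /f RintegralB; [|exact: measurable_itvR|exact: i0'|exact: i1].
  rewrite RintegralZl; [|exact: measurable_itvR|exact: i0].
  by rewrite /Gamma addrK.
have fi : (@lebesgue_measure R).-integrable `](0:R), +oo[ (EFin \o f).
  exact: (integrableB (measurable_itvR _) i0' i1).
have h0 n : 0 < harmonic n :> R by rewrite /harmonic invr_gt0.
have d2 := @cvg_natrS2y R.
have := cvg_Rintegral_itv_pos h0 cvg_harmonic d2 fi.
rewrite If.
have F0 (t : R) : 0 <= F t by rewrite mulr_ge0 ?powR_ge0 ?expR_ge0.
have dF (t : R) : 0 < t -> is_derive t 1 F (f t).
  move=> t0; have d1 := is_derive1_powR a t0.
  have dN := is_derive1_comp (is_derive_expR (- t)) (is_deriveNid t 1).
  apply: (is_derive_eq (is_deriveM d1 dN)).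
  by rewrite /f /GRing.scale /=; ring.
have cf (t : R) : 0 < t -> {for t, continuous f}.
  move=> t0; have ce : {for t, continuous (fun t : R => expR (- t))}.
    exact: is_derive_continuous (is_derive1_comp (is_derive_expR (- t)) (is_deriveNid t 1)).
  have cp (p : R) : {for t, continuous (fun u : R => u `^ p)}.
    exact: is_derive_continuous (is_derive1_powR p t0).
  have ca : {for t, continuous (cst a)} by exact: cst_continuous.
  exact: continuousB (continuousM ca (continuousM (cp (a - 1)) ce)) (continuousM (cp a) ce).
(* [harmonic n] is 1 / (n + 1) and equals 1 at n = 0, so the upper end has to start at 2. *)
have E n : F n.+2%:R - F (harmonic n) = \int[@lebesgue_measure R]_(t in `[harmonic n, n.+2%:R]) f t.
  have hn : harmonic n < n.+2%:R :> R.
    by rewrite (@le_lt_trans _ _ 1) ?ltr1n// invf_le1// ler1n.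
  have ht (t : R) : harmonic n <= t <= n.+2%:R -> 0 < t.
    by move=> /andP[+ _]; exact: lt_le_trans.
  by rewrite /Rintegral (is_derive_FTC2 hn (fun t h => dF t (ht t h)) (fun t h => cf t (ht t h))).
under eq_fun do rewrite -E.
have c0 : (fun n => F (harmonic n)) @ \oo --> 0.
  apply: (@squeeze_cvgr _ _ _ _ (cst 0) (fun n => (harmonic n : R) `^ a)).
  - apply: nearW => n; rewrite F0 ler_piMr ?powR_ge0// -expR0 ler_expR oppr_le0.
    exact/ltW/h0.
  - exact: cvg_cst.
  - by have /cvg_at_rightP := powR_cvg0 a0; apply; split => //; exact: cvg_harmonic.
(* [powR1D_le_expR] with exponent a + 1 at t = n + 1 gives (n + 2) ^ (a + 1) <= (a + 1) ^ (a + 1)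
   exp (n + 1); the spare power of n + 2 yields decay like 1 / (n + 1). *)
have c1 : (fun n => F n.+2%:R) @ \oo --> 0.
  apply: (@squeeze_cvgr _ _ _ _ (cst 0) (fun n => (a + 1) `^ (a + 1) * harmonic n)).
  - apply: nearW => n; rewrite F0 /F expRN ler_pdivrMr ?expR_gt0//.
    have h := powR1D_le_expR (p := a + 1) _ (ler0n R n.+1); move: h.
    rewrite -(@mulr_powRB1 _ (1 + n.+1%:R) (a + 1))// ?addrK -?nat1r ?nat1r//.
    rewrite /harmonic mulrAC ler_pdivlMr// => h.
    apply: le_trans (_ : _ <= n.+2%:R `^ a * n.+2%:R) _.
      by rewrite ler_wpM2l ?powR_ge0// ler_nat.
    rewrite mulrC; apply: le_trans (h _) _; first lra.
    by rewrite ler_wpM2l ?powR_ge0// ler_expR ler_nat.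
  - exact: cvg_cst.
  - by rewrite -[X in _ --> X](mulr0 ((a + 1) `^ (a + 1))); apply: cvgM; [exact: cvg_cst|exact: cvg_harmonic].
move=> cI; have := cvg_unique _ cI (cvgB c1 c0); rewrite subr0 => /(_ (@Rhausdorff _)).
by move=> /(_ _ _)/eqP; rewrite subr_eq0 => /eqP.
Qed.

End GammaFacts.

Opaque Gamma.

(** * Boundedness of sqrt t * J_nu t, by an energy argument *)

Section BesselBound.
Local Open Scope classical_set_scope.

Definition bessel_coef (R : realType) (nu : R) (k : nat) : R :=
  (-1) ^+ k / (k`!%:R * Gamma (k%:R + nu + 1)).

(** The Bessel-Clifford function at - z, the entire factor of J_nu: J_nu t = (t / 2) ^ nu g (t ^ 2 /
    4). Differentiation only raises the index and changes the sign. *)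
Definition bessel_reg (R : realType) (nu z : R) : R :=
  limn (pseries (bessel_coef nu) z).

(** Each step of the recurrence multiplies by k + nu + 1 >= 1. This puts the Bessel coefficients
    below a multiple of 1 / k!, so that the exponential series dominates. *)
Lemma Gamma_shift_ge (R : realType) (nu : R) (k : nat) : 0 <= nu ->
  Gamma (nu + 1) <= Gamma (k%:R + nu + 1).
Proof.
move=> nu0; elim: k => [|k ih]; first by rewrite add0r.
have p : 0 <= k%:R :> R by [].
rewrite -natr1 (_ : k%:R + 1 + nu + 1 = (k%:R + nu + 1) + 1); last by ring.
have q : 0 < k%:R + nu + 1 by lra.
rewrite (Gamma_rec q); apply: (le_trans ih).
by rewrite ler_peMl ?(ltW (Gamma_gt0 q))//; lra.
Qed.

Lemma normr_bessel_coef_le (R : realType) (nu : R) (k : nat) : 0 <= nu ->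
  `|bessel_coef nu k| <= (Gamma (nu + 1))^-1 / k`!%:R.
Proof.
move=> nu0; have g0 : 0 < Gamma (nu + 1) by apply: Gamma_gt0; lra.
have gk := Gamma_shift_ge k nu0; have gk0 := lt_le_trans g0 gk.
have f0 : 0 < k`!%:R :> R by rewrite ltr0n fact_gt0.
rewrite /bessel_coef normrM normrX normrN1 expr1n mul1r normfV normrM !gtr0_norm//.
move: (Gamma (nu + 1)) (Gamma _) g0 gk gk0 => G1 G2 g0 gk gk0.
by rewrite -invfM lef_pV2 ?posrE ?mulr_gt0// [leLHS]mulrC ler_wpM2l// ltW.
Qed.

Lemma cvg_bessel_norm_series (R : realType) (nu z : R) : 0 <= nu ->
  cvgn (series (fun k => `|bessel_coef nu k * z ^+ k|)).
Proof.
move=> nu0; have g0 : 0 < Gamma (nu + 1) by apply: Gamma_gt0; lra.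
apply: (@series_le_cvg _ _ ((Gamma (nu + 1))^-1 *: exp_coeff `|z|)) => //.
- by move=> k; rewrite /exp_coeff /= /GRing.scale /= mulr_ge0 ?divr_ge0 ?invr_ge0 ?(ltW g0) ?exprn_ge0.
- move=> k; rewrite normrM normrX.
  apply: le_trans (ler_wpM2r _ (normr_bessel_coef_le k nu0)) _; first exact: exprn_ge0.
  by rewrite /exp_coeff /GRing.scale /=; rewrite -!mulrA [_^-1 * `|z|^+k]mulrC.
- exact/is_cvg_seriesZ/is_cvg_series_exp_coeff.
Qed.

Lemma cvg_bessel_pseries (R : realType) (nu z : R) : 0 <= nu ->
  cvgn (pseries (bessel_coef nu) z).
Proof. by move=> nu0; apply: normed_cvg; exact: cvg_bessel_norm_series. Qed.

Lemma bessel_coef_diffs (R : realType) (nu : R) : 0 <= nu ->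
  pseries_diffs (bessel_coef nu) = - bessel_coef (nu + 1).
Proof.
move=> nu0; apply/funext => k; rewrite /pseries_diffs /bessel_coef fctE.
have g0 : 0 < Gamma (k.+1%:R + nu + 1).
  by apply: lt_le_trans (Gamma_shift_ge _ nu0); apply: Gamma_gt0; lra.
have f0 : 0 < k`!%:R :> R by rewrite ltr0n fact_gt0.
rewrite (_ : k%:R + (nu + 1) + 1 = k.+1%:R + nu + 1); last by rewrite -natr1; ring.
rewrite factS natrM exprS; field.
by rewrite !gt_eqF.
Qed.

Lemma is_derive_bessel_reg (R : realType) (nu z : R) : 0 <= nu ->
  is_derive z 1 (bessel_reg nu) (- bessel_reg (nu + 1) z).
Proof.
move=> nu0; have n1 : 0 <= nu + 1 by lra.
have n2 : 0 <= nu + 1 + 1 by lra.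
have cN mu : 0 <= mu -> forall w : R, cvgn (pseries (- bessel_coef mu) w).
  move=> mu0 w; rewrite /pseries (_ : (fun i => _) = - (fun i => bessel_coef mu i * w ^+ i)).
    by rewrite is_cvg_seriesN; exact: cvg_bessel_pseries.
  by apply/funext => i; rewrite !fctE mulNr.
(* Termwise differentiation needs the series and its first two derived series to converge at some
   radius beyond [|z|]; the derived series are again Bessel series, up to sign. *)
have := @pseries_snd_diffs _ (bessel_coef nu) (`|z| + 1) z.
have -> : - bessel_reg (nu + 1) z = limn (pseries (pseries_diffs (bessel_coef nu)) z).
  rewrite bessel_coef_diffs// /pseries (_ : (fun i => _) = - (fun i => bessel_coef (nu + 1) i * z ^+ i)).
    by rewrite lim_seriesN//; exact: cvg_bessel_pseries.
  by apply/funext => i; rewrite !fctE mulNr.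
apply.
- exact: cvg_bessel_pseries.
- by rewrite bessel_coef_diffs//; exact: cN.
- rewrite bessel_coef_diffs// pseries_diffsN bessel_coef_diffs// opprK.
  exact: cvg_bessel_pseries.
- by rewrite [ltRHS]ger0_norm ?addr_ge0// ltrDl.
Qed.

Lemma pseries_three_term (R : realType) (a0 a1 a2 : nat -> R) (c z : R) :
  a0 0%N = c * a1 0%N ->
  (forall n, a2 n + a0 n.+1 = c * a1 n.+1) ->
  cvgn (pseries a0 z) -> cvgn (pseries a1 z) -> cvgn (pseries a2 z) ->
  z * limn (pseries a2 z) - c * limn (pseries a1 z) + limn (pseries a0 z) = 0.
Proof.
move=> h0 hS c0 c1 c2.
(* Multiplication by [z] shifts a power series by one place, so with one term fewer for [a2] the
   identity is exact already for partial sums. *)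
have S n : z * pseries a2 z n - c * pseries a1 z n.+1 + pseries a0 z n.+1 = 0.
  rewrite /pseries /series /= mulr_sumr (big_nat_recl n)//= (big_nat_recl n)//=.
  have E (X A B C : R) : X - c * (A + B) + (c * A + C) = X - c * B + C by ring.
  rewrite !expr0 !mulr1 h0 E.
  rewrite mulr_sumr -sumrN -!big_split big1// => i _ /=.
  by rewrite exprS -(addrK (a0 i.+1) (a2 i)) hS; ring.
have H : (fun n => z * pseries a2 z n - c * pseries a1 z n.+1 + pseries a0 z n.+1)
    @ \oo --> z * limn (pseries a2 z) - c * limn (pseries a1 z) + limn (pseries a0 z).
  apply: cvgD; last by rewrite cvg_shiftS.
  apply: cvgB; apply: cvgM; try exact: cvg_cst; first exact: c2.
  by rewrite cvg_shiftS; exact: c1.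
move: H; under eq_fun do rewrite S.
by move=> H; have := cvg_unique _ H (cvg_cst 0) => /(_ (@Rhausdorff _) _ _).
Qed.

(** Over the common denominator (n + 1)! Gamma (n + nu + 3) this is (n + 1) - (n + nu + 2) = - (nu +
    1). *)
Lemma bessel_coef_three_term (R : realType) (nu : R) (n : nat) : 0 <= nu ->
  bessel_coef (nu + 1 + 1) n + bessel_coef nu n.+1 = (nu + 1) * bessel_coef (nu + 1) n.+1.
Proof.
move=> nu0; have p : 0 <= n%:R :> R by [].
have q : 0 < n.+1%:R + nu + 1 by rewrite -natr1; lra.
rewrite /bessel_coef.
rewrite (_ : n%:R + (nu + 1 + 1) + 1 = (n.+1%:R + nu + 1) + 1); last by rewrite -natr1; ring.
rewrite (_ : n.+1%:R + (nu + 1) + 1 = (n.+1%:R + nu + 1) + 1); last by ring.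
rewrite (Gamma_rec q); have := Gamma_gt0 q.
move: (Gamma _) => G G0; rewrite factS natrM !exprS; move: q; rewrite -natr1 => q.
have : 0 < n`!%:R :> R by rewrite ltr0n fact_gt0.
move: (n%:R) (n`!%:R) p q => N F p q F0.
by field; rewrite !gt_eqF//=; lra.
Qed.

(* As the derivative of bessel_reg nu is - bessel_reg (nu + 1), this is the Bessel
   equation z g'' + (nu + 1) g' + g = 0 for g = bessel_reg nu. *)
Lemma bessel_reg_rec (R : realType) (nu z : R) : 0 <= nu ->
  z * bessel_reg (nu + 1 + 1) z - (nu + 1) * bessel_reg (nu + 1) z
  + bessel_reg nu z = 0.
Proof.
move=> nu0; have n1 : 0 <= nu + 1 by lra.
have n2 : 0 <= nu + 1 + 1 by lra.
have c0 := @cvg_bessel_pseries R nu z nu0.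
have c1 := @cvg_bessel_pseries R (nu + 1) z n1.
have c2 := @cvg_bessel_pseries R (nu + 1 + 1) z n2.
apply: pseries_three_term c0 c1 c2 => [|n]; last exact: bessel_coef_three_term.
have p : 0 < nu + 1 by lra.
rewrite /bessel_coef !add0r (Gamma_rec p); have := Gamma_gt0 p.
move: (Gamma _) => G G0; rewrite fact0 !expr0.
by field; rewrite !gt_eqF.
Qed.

Lemma powRD1 (R : realType) (x p : R) : 0 < x -> x `^ (p + 1) = x * x `^ p.
Proof.
move=> x0; rewrite powRD; last by rewrite (gt_eqF x0) implybT.
by rewrite powRr1 ?(ltW x0)// mulrC.
Qed.

(* E = z ^ (nu + 1/2) (g ^ 2 + (al g + z g') ^ 2 / (z - m)) with g = bessel_reg nu,
   al = nu / 2 + 1 / 4 and m = (nu ^ 2 - 1/4) / 4; up to a constant factor this is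
   u ^ 2 + u' ^ 2 / (1 - (nu ^ 2 - 1/4) / t ^ 2) for u = sqrt t * J_nu t, t = 2 sqrt z. *)
Lemma bessel_energy_derive (R : realType) (nu z : R) : 0 <= nu -> 0 < z ->
  let m := (nu ^+ 2 - 1 / 4) / 4 in let al := nu / 2 + 1 / 4 in
  let p w := al * bessel_reg nu w - w * bessel_reg (nu + 1) w in
  m < z ->
  is_derive z 1 (fun w => w `^ (nu + 1 / 2) * (bessel_reg nu w ^+ 2 + p w ^+ 2 / (w - m)))
    (- (m * z `^ (nu - 1 / 2) * p z ^+ 2 / (z - m) ^+ 2)).
Proof.
move=> nu0 z0 m al p mz; have n1 : 0 <= nu + 1 by lra.
have zm : z - m != 0 by rewrite gt_eqF// subr_gt0.
have dg := is_derive_bessel_reg z nu0; have dg1 := is_derive_bessel_reg z n1.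
have dW := is_derive1_powR (nu + 1 / 2) z0.
have dzm : is_derive z 1 (fun w : R => w - m) 1.
  by have := is_deriveB (is_derive_id z 1) (is_derive_cst m z 1); rewrite subr0.
have dV := @is_deriveV R (fun w => w - m) z 1 1 zm dzm.
have dp := is_deriveB (is_deriveM (is_derive_cst al z 1) dg) (is_deriveM (is_derive_id z 1) dg1).
have dE := is_deriveM dW (is_deriveD (is_deriveX 2 dg) (is_deriveM (is_deriveX 2 dp) dV)).
apply: (is_derive_eq dE).
rewrite /p /GRing.scale /= !fctE /=.
(* The Bessel equation eliminates the index nu + 2 brought in by differentiating [p]. What remains
   is a rational identity in z, in g and in the function of index nu + 1. *)
have -> : bessel_reg (nu + 1 + 1) z = ((nu + 1) * bessel_reg (nu + 1) z - bessel_reg nu z) / z.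
  have := bessel_reg_rec z nu0; move: (bessel_reg _ z) (bessel_reg _ z) (bessel_reg _ z) => g0 g1 g2 h.
  by apply: (mulIf (lt0r_neq0 z0)); rewrite divfK ?lt0r_neq0//; lra.
have -> : nu + 1 / 2 - 1 = nu - 1 / 2 by lra.
have -> : z `^ (nu + 1 / 2) = z * z `^ (nu - 1 / 2).
  by rewrite -powRD1//; congr (_ `^ _); lra.
move: zm; rewrite /al /m.
move: (bessel_reg _ z) (bessel_reg _ z) (_ `^ _) => g0 g1 W zm.
field.
rewrite (lt0r_neq0 z0) andbT; apply: lt0r_neq0; move: mz; rewrite /m; lra.
Qed.

(** At z = t ^ 2 / 4 the bounded quantity is (t / 2) J_nu t ^ 2. The hypothesis [1 / 2 <= nu] makes
    [m] nonnegative, so the energy is nonincreasing to the right of its pole [m] and its value at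
    [m + 1] bounds the tail; on [0, m + 1] continuity of g suffices. *)
Lemma bessel_reg_bounded (R : realType) (nu : R) : 1 / 2 <= nu ->
  exists C, forall z, 0 <= z -> z `^ (nu + 1 / 2) * bessel_reg nu z ^+ 2 <= C.
Proof.
move=> nu12; have nu0 : 0 <= nu by lra.
pose m := (nu ^+ 2 - 1 / 4) / 4; pose al := nu / 2 + 1 / 4.
have m0 : 0 <= m by rewrite /m; nra.
pose p w := al * bessel_reg nu w - w * bessel_reg (nu + 1) w.
pose E w := w `^ (nu + 1 / 2) * (bessel_reg nu w ^+ 2 + p w ^+ 2 / (w - m)).
have dE w : m < w -> is_derive w 1 E
    (- (m * w `^ (nu - 1 / 2) * p w ^+ 2 / (w - m) ^+ 2)).
  by move=> mw; apply: bessel_energy_derive => //; exact: le_lt_trans mw.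
have cg : continuous (fun w => bessel_reg nu w ^+ 2).
  move=> w; exact: is_derive_continuous (is_deriveX 2 (is_derive_bessel_reg w nu0)).
have m1 : 0 <= m + 1 by lra.
have [c _ hc] := EVT_max m1 (continuous_subspaceT cg).
have tail (w : R) : m + 1 <= w -> w `^ (nu + 1 / 2) * bessel_reg nu w ^+ 2 <= E (m + 1).
  move=> mw; have mw' : m < w by lra.
  apply: (@le_trans _ _ (E w)).
    rewrite ler_wpM2l ?powR_ge0// lerDl divr_ge0 ?sqr_ge0// subr_ge0; exact: ltW.
  move: mw; rewrite le_eqVlt => /predU1P[->//|mw].
  have dE' (y : R) : y \in `]m + 1, w[%R -> is_derive y 1 E
      (- (m * y `^ (nu - 1 / 2) * p y ^+ 2 / (y - m) ^+ 2)).
    by rewrite in_itv/= => /andP[h _]; apply: dE; lra.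
  have cE : {within `[m + 1, w], continuous E}.
    apply: continuous_in_subspaceT => y; rewrite inE/= in_itv/= => /andP[h _].
    by apply: is_derive_continuous (dE y _); lra.
  have [y _ Ey] := MVT mw dE' cE.
  rewrite -subr_le0 Ey mulNr oppr_le0 mulr_ge0//; last by rewrite subr_ge0 ltW.
  apply: divr_ge0 (sqr_ge0 _); apply: mulr_ge0 (sqr_ge0 _).
  exact: mulr_ge0 m0 (powR_ge0 _ _).
exists (Num.max (E (m + 1)) ((m + 1) `^ (nu + 1 / 2) * bessel_reg nu c ^+ 2)) => z z0.
rewrite le_max; have [/tail ->//|zm] := leP (m + 1) z.
apply/orP; right; rewrite ler_pM ?powR_ge0 ?sqr_ge0//; last first.
  by apply: hc; rewrite in_itv/= z0 ltW.
by rewrite ge0_ler_powR ?nnegrE//; [lra|exact: ltW].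
Qed.

Lemma besselJ_reg (R : realType) (nu t : R) : 0 <= nu -> 0 < t ->
  besselJ nu t = (t / 2) `^ nu * bessel_reg nu (t ^+ 2 / 4).
Proof.
move=> nu0 t0; rewrite /bessel_reg -[RHS]lim_seriesZ; last exact: cvg_bessel_pseries.
rewrite /besselJ; congr (limn (series _)); apply/funext => k.
have t2 : 0 < t / 2 by rewrite divr_gt0.
rewrite -[_ / (_ * _)]/(bessel_coef nu k) fctE /GRing.scale /= mulrCA; congr (_ * _).
rewrite powRD; last by rewrite (gt_eqF t2) implybT.
rewrite mulrC -natrM powR_mulrn ?(ltW t2)// exprM; congr (_ * _ ^+ _).
by field.
Qed.

(** A real [sup] bounds the members of its set only if the set is bounded above, so a bound has to
    be exhibited. *)
Lemma sqrt_besselJ_le_const (R : realType) (nu t : R) : 1 / 2 <= nu -> 0 <= t ->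
  Num.sqrt t * `|besselJ nu t| <= besselJ_const nu.
Proof.
move=> nu12 t0; have nu0 : 0 < nu by lra.
have [C hC] := bessel_reg_bounded nu12.
apply: ub_le_sup; last by exists t.
have C0 : 0 <= C.
  by apply: le_trans (hC 1 _) => //; rewrite mulr_ge0 ?powR_ge0 ?sqr_ge0.
(* With z = s ^ 2 / 4 one has s * J_nu s ^ 2 = 2 z ^ (nu + 1 / 2) g z ^ 2, whence the factor 2. *)
exists (Num.sqrt (2 * C)) => _ [s /= s0 <-].
have [->|sn0] := eqVneq s 0.
  by rewrite sqrtr0 mul0r sqrtr_ge0.
have {sn0}s0 : 0 < s by rewrite lt0r sn0.
have s2 : 0 < s / 2 by rewrite divr_gt0.
rewrite -(@ler_pXn2r _ 2) ?nnegrE ?mulr_ge0 ?sqrtr_ge0//.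
rewrite exprMn !sqr_sqrtr ?(ltW s0) ?mulr_ge0// real_normK ?num_real//.
have /hC : 0 <= s ^+ 2 / 4 by rewrite divr_ge0 ?sqr_ge0.
rewrite besselJ_reg ?(ltW nu0)// (_ : s ^+ 2 / 4 = (s / 2) `^ 2%:R); last first.
  by rewrite powR_mulrn ?(ltW s2)//; field.
rewrite -powRrM (_ : 2 * (nu + 1 / 2) = nu + nu + 1); last by lra.
rewrite powRD1// powRD; last by rewrite (gt_eqF s2) implybT.
move: (_ `^ nu) (bessel_reg _ _) => W g h; rewrite exprMn; nra.
Qed.

End BesselBound.

(** * Termwise integration of series and Weber's integral *)

Section TermwiseIntegration.
Local Open Scope classical_set_scope.

Lemma nneseries_EFin_le (R : realType) (u : nat -> R) : (forall n, 0 <= u n) ->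
  cvgn (series u) -> (\sum_(0 <= k <oo) (u k)%:E <= (limn (series u))%:E)%E.
Proof.
move=> u0 cu; apply: lime_le; first by apply: is_cvg_nneseries => n _ _; rewrite lee_fin.
apply: nearW => n; rewrite sumEFin lee_fin.
apply: nondecreasing_cvgn_le cu n.
by apply/nondecreasing_seqP => n; rewrite seriesSr lerDl.
Qed.

(** Dominated convergence for the partial sums. The dominating function is the sum of all [|f n|]:
    by monotone convergence its integral is the sum of [u], hence finite. *)
Lemma Rintegral_series (d : measure_display) (T : measurableType d) (R : realType)
    (mu : {measure set T -> \bar R}) (D : set T) (f : nat -> T -> R) (F : T -> R)
    (u : nat -> R) :
  measurable D -> (forall n, measurable_fun D (f n)) ->
  (forall n, \int[mu]_(x in D) `|(f n x)%:E| = (u n)%:E)%E ->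
  cvgn (series u) ->
  (forall x, D x -> series (fun n => f n x) @ \oo --> F x) ->
  mu.-integrable D (EFin \o F) /\
  series (fun n => \int[mu]_(x in D) f n x) @ \oo --> \int[mu]_(x in D) F x.
Proof.
move=> mD mf fu cu fF.
have u0 n : 0 <= u n by rewrite -lee_fin -fu integral_ge0.
have mfe n : measurable_fun D (fun x => `|(f n x)%:E|%E).
  by apply: measurableT_comp => //; apply/measurable_EFinP; exact: mf.
pose g x := (\sum_(0 <= k <oo) `|(f k x)%:E|)%E.
have g0 x : (0 <= g x)%E by apply: nneseries_ge0 => n _ _.
have mg : measurable_fun D g.
  exact: (@ge0_emeasurable_sum _ _ _ D (fun k x => `|(f k x)%:E|%E) predT).
have ig : mu.-integrable D g.
  apply/integrableP; split => //.
  under eq_integral do rewrite gee0_abs//.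
  rewrite integral_nneseries//; under eq_eseriesr do rewrite fu.
  exact: le_lt_trans (nneseries_EFin_le u0 cu) (ltry _).
have iF n : mu.-integrable D (EFin \o f n).
  apply/integrableP; split; first exact/measurable_EFinP.
  by rewrite /= fu ltry.
pose f_ n x := (series (fun k => f k x) n)%:E.
have ms n : measurable_fun D (fun x => series (fun k => f k x) n).
  exact: measurable_sum.
have mf_ n : measurable_fun D (f_ n) by apply/measurable_EFinP.
have mF : measurable_fun D (EFin \o F).
  by apply/measurable_EFinP; exact: measurable_fun_cvg ms fF.
have f_f : {ae mu, forall x, D x -> f_ ^~ x @ \oo --> (EFin \o F) x}.
  by apply: aeW => x Dx; apply: cvg_EFin; [exact: nearW|exact: fF].
have f_g : {ae mu, forall x n, D x -> (`|f_ n x| <= g x)%E}.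
  apply: aeW => x n Dx.
  apply: le_trans (nneseries_lim_ge n _) => //.
  rewrite /f_ -sumEFin; exact: lee_abs_sum.
have [iF' _ cI] := dominated_convergence mD mf_ mF f_f ig f_g.
split => //.
have E n : (\int[mu]_(x in D) f_ n x = (series (fun n => \int[mu]_(x in D) f n x) n)%:E)%E.
  rewrite /f_ /series /=; under eq_integral do rewrite -sumEFin.
  rewrite integral_sum//.
  rewrite -sumEFin; apply: eq_bigr => k _.
  by rewrite /Rintegral fineK//; exact: integrable_fin_num (iF k).
move: cI; rewrite (_ : (fun n => _) = EFin \o series (fun n => \int[mu]_(x in D) f n x)); last first.
  by apply/funext => n; exact: E.
by rewrite -(fineK (integrable_fin_num mD iF')) => /fine_cvg.
Qed.

Lemma ge0_integral_powR_expR (R : realType) (a c : R) : 0 < a -> 0 < c ->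
  (\int[@lebesgue_measure R]_(t in `]0%R, +oo[) (t `^ (a - 1) * expR (- (c * t)))%:E
   = (Gamma a * c `^ (- a))%:E)%E.
Proof.
move=> a0 c0; have mf : measurable_fun `](0 : R), +oo[ (fun t => (t `^ (a - 1) * expR (- t))%:E).
  by apply/measurable_EFinP; exact: measurable_powR_expRN.
have f0 (t : R) : 0 < t -> (0 <= (t `^ (a - 1) * expR (- t))%:E)%E.
  by rewrite lee_fin mulr_ge0 ?powR_ge0 ?expR_ge0.
have := ge0_integral_scale c0 mf f0; rewrite integral_Gamma//.
have -> : (\int[@lebesgue_measure R]_(x in `]0%R, +oo[) ((c * x) `^ (a - 1) * expR (- (c * x)))%:E =
  (c `^ (a - 1))%:E * \int[@lebesgue_measure R]_(t in `]0%R, +oo[) (t `^ (a - 1) * expR (- (c * t)))%:E)%E.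
  rewrite -ge0_integralZl_EFin ?powR_ge0//.
  - apply: eq_integral => t; rewrite inE/= in_itv/= andbT => t0.
    by rewrite -EFinM mulrA powRM ?(ltW c0) ?(ltW t0).
  - by move=> t _; rewrite lee_fin mulr_ge0 ?powR_ge0 ?expR_ge0.
  - by apply/measurable_EFinP; exact: measurable_powR_expR.
rewrite muleA -EFinM mulr_powRB1 ?(ltW c0)// => h.
have ca : c `^ (- a) * c `^ a = 1 by rewrite powRN mulVf// gt_eqF ?powR_gt0.
by rewrite mulrC [RHS]EFinM -h muleA -EFinM ca mul1e.
Qed.

Lemma integrable_powR_expR (R : realType) (a c : R) : 0 < a -> 0 < c ->
  (@lebesgue_measure R).-integrable `](0 : R), +oo[
    (EFin \o (fun t => t `^ (a - 1) * expR (- (c * t)))).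
Proof.
move=> a0 c0; apply/integrableP; split.
  by apply/measurable_EFinP; exact: measurable_powR_expR.
rewrite /=; under eq_integral do rewrite ger0_norm ?mulr_ge0 ?powR_ge0 ?expR_ge0//.
by rewrite ge0_integral_powR_expR// ltry.
Qed.

Lemma Rintegral_powR_expR (R : realType) (a c : R) : 0 < a -> 0 < c ->
  \int[@lebesgue_measure R]_(t in `]0, +oo[) (t `^ (a - 1) * expR (- (c * t))) =
  Gamma a * c `^ (- a).
Proof. by move=> a0 c0; rewrite /Rintegral ge0_integral_powR_expR. Qed.

(* Weber's integral, in the variable s = y ^ 2. *)
Lemma besselJ_Laplace (R : realType) (nu x t : R) : 0 <= nu -> 0 < x -> 0 < t ->
  let f s := besselJ nu (x * Num.sqrt s) * s `^ (nu / 2) * expR (- (t * s)) in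
  (@lebesgue_measure R).-integrable `](0 : R), +oo[ (EFin \o f) /\
  \int[@lebesgue_measure R]_(s in `]0, +oo[) f s =
    (x / 2) `^ nu * t `^ (- nu - 1) * expR (- (x ^+ 2 / (4 * t))).
Proof.
move=> nu0 x0 t0 f.
pose h k (s : R) := (x / 2) `^ nu * (bessel_coef nu k * (x ^+ 2 / 4) ^+ k)
  * (s `^ (k%:R + nu + 1 - 1) * expR (- (t * s))).
pose v := (x / 2) `^ nu * t `^ (- nu - 1).
pose w := x ^+ 2 / (4 * t).
have x2 : 0 < x / 2 by rewrite divr_gt0.
have w0 : 0 <= w by rewrite divr_ge0 ?sqr_ge0// mulr_ge0// ltW.
have v0 : 0 <= v by rewrite mulr_ge0 ?powR_ge0.
have kp k : 0 < k%:R + nu + 1 :> R by have : 0 <= k%:R :> R by []; lra.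
(* The Gamma factor produced by integrating the [k]-th term cancels the one in the Bessel
   coefficient and leaves the exponential series at [- w]. *)
have bk k : bessel_coef nu k * (x ^+ 2 / 4) ^+ k * (Gamma (k%:R + nu + 1) * t `^ (- (k%:R + nu + 1)))
    = t `^ (- nu - 1) * exp_coeff (- w) k.
  rewrite /bessel_coef; have := Gamma_gt0 (kp k); move: (Gamma _) => G G0.
  rewrite (_ : - (k%:R + nu + 1) = (- nu - 1) + - k%:R); last by ring.
  rewrite powRD; last by rewrite (gt_eqF t0) implybT.
  rewrite powRN powR_mulrn ?(ltW t0)// /exp_coeff /=.
  have -> : (- w) ^+ k = (-1) ^+ k * (x ^+ 2 / 4) ^+ k / t ^+ k.
    rewrite -mulrA -exprVn -!exprMn; congr (_ ^+ _); rewrite /w; field; by rewrite gt_eqF.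
  have : 0 < k`!%:R :> R by rewrite ltr0n fact_gt0.
  have : 0 < t ^+ k by rewrite exprn_gt0.
  move: (k`!%:R) (t ^+ k) ((-1) ^+ k) (_ ^+ k) (_ `^ _) => A B C D E B0 A0.
  by field; rewrite !gt_eqF.
have hi k : (@lebesgue_measure R).-integrable `](0 : R), +oo[ (EFin \o h k).
  exact: (integrableZl (measurable_itvR _) _ (integrable_powR_expR (kp k) t0)).
have Ih k : \int[@lebesgue_measure R]_(s in `]0, +oo[) h k s = v * exp_coeff (- w) k.
  rewrite /h RintegralZl//; last exact: integrable_powR_expR.
  by rewrite Rintegral_powR_expR// -mulrA bk mulrA.
(* In absolute value the signs disappear and the same computation gives the exponential series at
   [w], which supplies the summability needed for termwise integration. *)
have Ah k : (\int[@lebesgue_measure R]_(s in `]0%R, +oo[) `|(h k s)%:E| = (v * exp_coeff w k)%:E)%E.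
  have pos s : 0 <= s `^ (k%:R + nu + 1 - 1) * expR (- (t * s)).
    by rewrite mulr_ge0 ?powR_ge0 ?expR_ge0.
  have gp : 0 <= Gamma (k%:R + nu + 1) * t `^ (- (k%:R + nu + 1)).
    by rewrite mulr_ge0 ?powR_ge0// ltW// Gamma_gt0.
  rewrite /h; under eq_integral do rewrite abse_EFin normrM (ger0_norm (pos _)) EFinM.
  rewrite ge0_integralZl_EFin//.
  - rewrite ge0_integral_powR_expR// -EFinM; congr EFin.
    rewrite -[X in _ * X](ger0_norm gp) -normrM -mulrA bk mulrA -/v.
    by rewrite normrM (ger0_norm v0) /exp_coeff /= normrM normrX normrN (ger0_norm w0) ger0_norm// invr_ge0.
  - by move=> s _; rewrite lee_fin.
  - by apply/measurable_EFinP; exact: measurable_powR_expR.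
have cw : cvgn (series (fun k => v * exp_coeff w k)).
  exact: (is_cvg_seriesZ (k := v) (is_cvg_series_exp_coeff w)).
have hf s : `](0 : R), +oo[ s -> series (fun k => h k s) @ \oo --> f s.
  rewrite /= in_itv/= andbT => s0.
  have sq0 : 0 < Num.sqrt s by rewrite sqrtr_gt0.
  have -> : f s = (x / 2) `^ nu * s `^ nu * expR (- (t * s)) * bessel_reg nu (x ^+ 2 * s / 4).
    rewrite /f besselJ_reg ?mulr_gt0// exprMn sqr_sqrtr ?(ltW s0)//.
    have -> : (x * Num.sqrt s / 2) `^ nu = (x / 2) `^ nu * s `^ (nu / 2).
      rewrite (_ : x * Num.sqrt s / 2 = (x / 2) * Num.sqrt s); last by ring.
      rewrite powRM ?(ltW sq0) ?(ltW x2)// -(powR12_sqrt (ltW s0)) -powRrM.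
      by rewrite [2^-1 * nu]mulrC.
    have -> : s `^ nu = s `^ (nu / 2) * s `^ (nu / 2).
      rewrite -powRD; last by rewrite (gt_eqF s0) implybT.
      by congr (_ `^ _); lra.
    by ring.
  have -> : series (fun k => h k s) = (fun n =>
      (x / 2) `^ nu * s `^ nu * expR (- (t * s)) * pseries (bessel_coef nu) (x ^+ 2 * s / 4) n).
    apply/funext => n; rewrite /pseries /series /= mulr_sumr; apply: eq_bigr => k _.
    rewrite /h (_ : k%:R + nu + 1 - 1 = k%:R + nu); last by ring.
    rewrite powRD; last by rewrite (gt_eqF s0) implybT.
    rewrite powR_mulrn ?(ltW s0)//.
    have -> : (x ^+ 2 * s / 4) ^+ k = (x ^+ 2 / 4) ^+ k * s ^+ k.
      by rewrite -exprMn; congr (_ ^+ _); ring.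
    by ring.
  by apply: cvgM; [exact: cvg_cst|exact: cvg_bessel_pseries].
have [iF cI] := Rintegral_series (measurable_itvR _) (fun k => (measurable_EFinP _ _).1 (measurable_int _ (hi k))) Ah cw hf.
split; first exact: iF.
move: cI; rewrite (_ : series _ = (fun n => v * series (exp_coeff (- w)) n)); last first.
  by apply/funext => n; rewrite /series /= mulr_sumr; apply: eq_bigr => k _; exact: Ih.
have ce : (fun n => v * series (exp_coeff (- w)) n) @ \oo --> v * expR (- w).
  by apply: cvgM; [exact: cvg_cst|exact: is_cvg_series_exp_coeff].
by move=> cI; have := cvg_unique _ cI ce => /(_ (@Rhausdorff _) _).
Qed.

End TermwiseIntegration.

(** * Symmetry of the Laplace transform by Fubini *)

Section LaplaceFubini.
Local Open Scope classical_set_scope.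

(** Both factors are cut off to the positive half-line, so that Fubini can be used on the whole
    plane. *)
Definition laplace_kernel (R : realType) (phi psi : R -> R) (z : R * R) : R :=
  (phi \_ `]0, +oo[) z.1 * (psi \_ `]0, +oo[) z.2 * expR (- (z.1 * z.2)).

Definition laplace (R : realType) (f : R -> R) (t : R) : R :=
  \int[@lebesgue_measure R]_(s in `]0, +oo[) (f s * expR (- (t * s))).

Lemma measurable_restrict_pos (R : realType) (phi : R -> R) :
  measurable_fun `](0 : R), +oo[ phi -> measurable_fun setT (phi \_ `](0 : R), +oo[).
Proof. by move=> mphi; apply/(measurable_restrictT _ _).1. Qed.

Lemma measurable_laplace_kernel (R : realType) (phi psi : R -> R) :
  measurable_fun `](0 : R), +oo[ phi -> measurable_fun `](0 : R), +oo[ psi ->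
  measurable_fun [set: measurableTypeR R * measurableTypeR R] (laplace_kernel phi psi).
Proof.
move=> mphi mpsi; apply: measurable_funM; first apply: measurable_funM.
- exact: (measurableT_comp (measurable_restrict_pos mphi)).
- exact: (measurableT_comp (measurable_restrict_pos mpsi)).
- apply: measurableT_comp; first exact: measurable_expR.
  by apply: measurable_funN; apply: measurable_funM.
Qed.

Lemma integral_laplace_kernel1 (R : realType) (phi psi : R -> R) (t : R) :
  (0 < t -> (@lebesgue_measure R).-integrable `](0 : R), +oo[
     (EFin \o (fun s => psi s * expR (- (t * s))))) ->
  (\int[@lebesgue_measure R]_s (laplace_kernel phi psi (t, s))%:E =
   (((fun t => phi t * laplace psi t) \_ `]0, +oo[) t)%:E)%E.
Proof.
move=> ipsi; rewrite /laplace_kernel /= !patchE; case: ifPn => [|_]; last first.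
  by under eq_integral do rewrite !mul0r; rewrite integral0.
rewrite inE/= in_itv/= andbT => t0; have it := ipsi t0.
rewrite EFinM /laplace /Rintegral fineK; last exact: (integrable_fin_num (measurable_itvR _) it).
rewrite -integralZl//.
rewrite [RHS]integral_mkcond; apply: eq_integral => s _.
by rewrite !patchE; case: ifPn => _; rewrite ?mulr0 ?mul0r// -EFinM mulrA.
Qed.

Lemma laplace_kernel_swap (R : realType) (phi psi : R -> R) (t s : R) :
  laplace_kernel phi psi (t, s) = laplace_kernel psi phi (s, t).
Proof. by rewrite /laplace_kernel /= [t * s]mulrC [X in X * _ = _]mulrC. Qed.

(* Symmetry of the Laplace transform: both sides are the integral of
   phi t * psi s * exp (- t s). *)
Lemma Laplace_sym (R : realType) (phi psi : R -> R) :
  measurable_fun `](0 : R), +oo[ phi -> measurable_fun `](0 : R), +oo[ psi ->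
  (forall t, 0 < t -> (@lebesgue_measure R).-integrable `](0 : R), +oo[
     (EFin \o (fun s => psi s * expR (- (t * s))))) ->
  (forall t, 0 < t -> (@lebesgue_measure R).-integrable `](0 : R), +oo[
     (EFin \o (fun s => phi s * expR (- (t * s))))) ->
  (@lebesgue_measure R \x @lebesgue_measure R)%E.-integrable setT
     (EFin \o laplace_kernel phi psi) ->
  [/\ (@lebesgue_measure R).-integrable `](0 : R), +oo[ (EFin \o (fun t => phi t * laplace psi t)),
      measurable_fun `](0 : R), +oo[ (fun t => psi t * laplace phi t) &
      \int[@lebesgue_measure R]_(t in `]0, +oo[) (phi t * laplace psi t) =
      \int[@lebesgue_measure R]_(t in `]0, +oo[) (psi t * laplace phi t)].
Proof.
move=> mphi mpsi ipsi iphi iK.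
have E1 t := integral_laplace_kernel1 phi (ipsi t).
have E2 t := integral_laplace_kernel1 psi (iphi t).
have e1 : fubini_F (@lebesgue_measure R) (EFin \o laplace_kernel phi psi) =
    EFin \o ((fun t => phi t * laplace psi t) \_ `](0 : R), +oo[).
  by apply/funext => t; exact: E1.
have e2 : fubini_G (@lebesgue_measure R) (EFin \o laplace_kernel phi psi) =
    EFin \o ((fun t => psi t * laplace phi t) \_ `](0 : R), +oo[).
  apply/funext => t; rewrite /= -E2 /fubini_G /=.
  by under eq_integral do rewrite laplace_kernel_swap.
have F1 : (@lebesgue_measure R).-integrable setT
    (EFin \o ((fun t => phi t * laplace psi t) \_ `](0 : R), +oo[)).
  by rewrite -e1; exact: (integrable_fubini_F iK).
have F2 : measurable_fun [set: measurableTypeR R]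
    (EFin \o ((fun t => psi t * laplace phi t) \_ `](0 : R), +oo[)).
  by rewrite -e2; exact: (measurable_fubini_G iK).
have i1 : (@lebesgue_measure R).-integrable `](0 : R), +oo[ (EFin \o (fun t => phi t * laplace psi t)).
  by apply/(integrable_mkcond _ (measurable_itvR _)); rewrite restrict_EFin.
have i2 : measurable_fun `](0 : R), +oo[ (fun t => psi t * laplace phi t).
  exact: ((measurable_restrictT _ (measurable_itvR _)).2 ((measurable_EFinP _ _).1 F2)).
pose P := (fun t => phi t * laplace psi t) \_ `](0 : R), +oo[.
pose Q := (fun t => psi t * laplace phi t) \_ `](0 : R), +oo[.
have H : (\int[@lebesgue_measure R]_t (EFin \o P) t = \int[@lebesgue_measure R]_t (EFin \o Q) t)%E.
  rewrite -[EFin \o P]e1 -[EFin \o Q]e2.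
  exact (Fubini iK).
split; [exact: i1|exact: i2|].
rewrite [LHS]Rintegral_mkcond [RHS]Rintegral_mkcond.
exact (congr1 fine H).
Qed.

End LaplaceFubini.

(** * The model pair of power functions and comparison with it *)

Section PowerKernel.
Local Open Scope classical_set_scope.

(** [Laplace_sym] yields integrability of one of its two integrands only; exchanging the roles of
    [phi] and [psi] yields the other. *)
Lemma integrable_laplace_kernelC (R : realType) (phi psi : R -> R) :
  measurable_fun `](0 : R), +oo[ phi -> measurable_fun `](0 : R), +oo[ psi ->
  (@lebesgue_measure R \x @lebesgue_measure R)%E.-integrable setT
     (EFin \o laplace_kernel phi psi) ->
  (@lebesgue_measure R \x @lebesgue_measure R)%E.-integrable setT
     (EFin \o laplace_kernel psi phi).
Proof.
move=> mphi mpsi iK.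
have m1 : measurable_fun [set: measurableTypeR R * measurableTypeR R] (EFin \o laplace_kernel phi psi).
  by apply/measurable_EFinP; exact: measurable_laplace_kernel.
have m2 : measurable_fun [set: measurableTypeR R * measurableTypeR R] (EFin \o laplace_kernel psi phi).
  by apply/measurable_EFinP; exact: measurable_laplace_kernel.
have := (integrable21ltyP _ _ m1).1 iK => H.
apply: (integrable12ltyP _ _ m2).2.
move: H; under eq_integral do under eq_integral do rewrite /= laplace_kernel_swap.
by [].
Qed.

Lemma integrable_laplace_kernel_le (R : realType) (phi psi phi0 psi0 : R -> R) :
  measurable_fun `](0 : R), +oo[ phi -> measurable_fun `](0 : R), +oo[ psi ->
  (forall t, 0 < t -> `|phi t| <= phi0 t) ->
  (forall s, 0 < s -> `|psi s| <= psi0 s) ->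
  (@lebesgue_measure R \x @lebesgue_measure R)%E.-integrable setT
     (EFin \o laplace_kernel phi0 psi0) ->
  (@lebesgue_measure R \x @lebesgue_measure R)%E.-integrable setT
     (EFin \o laplace_kernel phi psi).
Proof.
move=> mphi mpsi hphi hpsi iK; apply: le_integrable iK => //.
  by apply/measurable_EFinP; exact: measurable_laplace_kernel.
move=> [t s] _; rewrite /= lee_fin /laplace_kernel /= !normrM ler_wpM2r//.
rewrite !patchE; apply: ler_pM => //.
  case: ifPn => //; rewrite inE/= in_itv/= andbT => t0.
  by rewrite (le_trans (hphi t t0))// ler_norm.
case: ifPn => //; rewrite inE/= in_itv/= andbT => s0.
by rewrite (le_trans (hpsi s s0))// ler_norm.
Qed.

Lemma laplace_powR (R : realType) (b M t : R) : 0 < b -> 0 < t ->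
  (@lebesgue_measure R).-integrable `](0 : R), +oo[
    (EFin \o (fun s => M * s `^ (b - 1) * expR (- (t * s)))) /\
  laplace (fun s => M * s `^ (b - 1)) t = M * (Gamma b * t `^ (- b)).
Proof.
move=> b0 t0; have i0 := integrable_powR_expR b0 t0.
have E : (fun s : R => M * s `^ (b - 1) * expR (- (t * s))) =
    (fun s => M * (s `^ (b - 1) * expR (- (t * s)))).
  by apply/funext => s; rewrite mulrA.
split; first by rewrite E; exact: (integrableZl (measurable_itvR _) M i0).
by rewrite /laplace E RintegralZl// Rintegral_powR_expR.
Qed.

Lemma laplace_powR_expRN (R : realType) (a s : R) : 0 < a -> 0 < s ->
  (@lebesgue_measure R).-integrable `](0 : R), +oo[
    (EFin \o (fun t => t `^ (a - 1) * expR (- t) * expR (- (s * t)))) /\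
  laplace (fun t => t `^ (a - 1) * expR (- t)) s = Gamma a * (1 + s) `^ (- a).
Proof.
move=> a0 s0; have s1 : 0 < 1 + s by lra.
have E : (fun t : R => t `^ (a - 1) * expR (- t) * expR (- (s * t))) =
    (fun t => t `^ (a - 1) * expR (- ((1 + s) * t))).
  by apply/funext => t; rewrite -mulrA -expRD; congr (_ * expR _); ring.
by rewrite /laplace E Rintegral_powR_expR//; split => //; exact: integrable_powR_expR.
Qed.

Lemma measurable_powR_mul (R : realType) (M p : R) (D : set R) :
  measurable_fun D (fun s : R => M * s `^ p).
Proof.
by apply: measurable_funTS; apply: measurable_funM => //; exact: measurable_powR.
Qed.

(** The kernel is nonnegative and the inner integral explicit, so Tonelli leaves the Gamma integral
    of exponent a - b; [b < a] is its convergence at 0. *)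
Lemma integrable_power_kernel (R : realType) (a b M : R) : 0 < b -> b < a -> 0 <= M ->
  (@lebesgue_measure R \x @lebesgue_measure R)%E.-integrable setT
    (EFin \o laplace_kernel (fun t => t `^ (a - 1) * expR (- t)) (fun s => M * s `^ (b - 1))) /\
  \int[@lebesgue_measure R]_(t in `]0, +oo[)
    (t `^ (a - 1) * expR (- t) * laplace (fun s => M * s `^ (b - 1)) t) =
    M * (Gamma b * Gamma (a - b)).
Proof.
move=> b0 ba M0; have ab : 0 < a - b by lra.
have E (t : R) : 0 < t -> t `^ (a - 1) * expR (- t) * laplace (fun s => M * s `^ (b - 1)) t =
    M * Gamma b * (t `^ (a - b - 1) * expR (- t)).
  move=> t0; rewrite (laplace_powR M b0 t0).2 (_ : a - b - 1 = a - 1 + - b); last by ring.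
  by rewrite (@powRD _ t (a - 1) (- b)); [ring|rewrite (gt_eqF t0) implybT].
have iab := integrable_powR_expRN ab.
have mK : measurable_fun [set: measurableTypeR R * measurableTypeR R] (EFin \o
    laplace_kernel (fun t : R => t `^ (a - 1) * expR (- t)) (fun s => M * s `^ (b - 1))).
  apply/measurable_EFinP; apply: measurable_laplace_kernel.
    exact: measurable_powR_expRN.
  exact: measurable_powR_mul.
have K0 z : 0 <= laplace_kernel (fun t : R => t `^ (a - 1) * expR (- t)) (fun s => M * s `^ (b - 1)) z.
  rewrite /laplace_kernel !mulr_ge0 ?expR_ge0// patchE; case: ifPn => // _.
    by rewrite mulr_ge0 ?powR_ge0 ?expR_ge0.
  by rewrite mulr_ge0 ?powR_ge0.
split.
  apply/(integrable12ltyP _ _ mK).2.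
  under eq_integral do under eq_integral do rewrite /= ger0_norm//.
  under eq_integral do rewrite (integral_laplace_kernel1 _ (fun t0 => (laplace_powR M b0 t0).1)).
  rewrite (_ : (fun t => _) = (fun t => (((fun t => M * Gamma b * (t `^ (a - b - 1) * expR (- t))) \_ `](0 : R), +oo[) t)%:E)); last first.
    apply/funext => t; rewrite !patchE; case: ifPn => //.
    by rewrite inE/= in_itv/= andbT => /E ->.
  have := integrableZl (measurable_itvR _) (M * Gamma b) iab.
  move/(integrable_mkcond _ (measurable_itvR _)).
  rewrite restrict_EFin => /integrableP[_]; apply: le_lt_trans.
  rewrite le_eqVlt; apply/orP; left; apply/eqP; apply: eq_integral => t _ /=.
  rewrite ger0_norm// patchE; case: ifPn => // _.
  by rewrite !mulr_ge0 ?powR_ge0 ?expR_ge0// ltW// Gamma_gt0.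
transitivity (\int[@lebesgue_measure R]_(t in `]0, +oo[)
    (M * Gamma b * (t `^ (a - b - 1) * expR (- t)))).
  by apply: eq_Rintegral => t; rewrite inE/= in_itv/= andbT => /E.
by rewrite RintegralZl// -/(Gamma (a - b)) mulrA.
Qed.

Lemma measurable_laplace_integrand (R : realType) (f : R -> R) (t : R) (D : set R) :
  measurable_fun D f -> measurable_fun D (fun s => f s * expR (- (t * s))).
Proof.
move=> mf; apply: measurable_funM => //; apply: measurable_funTS.
apply: measurableT_comp; first exact: measurable_expR.
by apply: measurable_funN; exact: mulrl_measurable.
Qed.

(** The pairing is moved to the [s] side, where the bound on [laplace phi] keeps the cancellation
    due to oscillation; estimating [phi] on the [t] side would lose it. *)
Lemma laplace_pairing_le (R : realType) (a b M G : R) (phi psi : R -> R) :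
  0 < b -> b < a -> 0 <= M -> 0 <= G ->
  measurable_fun `](0 : R), +oo[ phi -> measurable_fun `](0 : R), +oo[ psi ->
  (forall t, 0 < t -> `|phi t| <= t `^ (a - 1) * expR (- t)) ->
  (forall s, 0 < s -> `|psi s| <= M * s `^ (b - 1)) ->
  (forall s, 0 < s -> `|laplace phi s| <= G * (Gamma a * (1 + s) `^ (- a))) ->
  (@lebesgue_measure R).-integrable `](0 : R), +oo[ (EFin \o (fun t => phi t * laplace psi t)) /\
  `|\int[@lebesgue_measure R]_(t in `]0, +oo[) (phi t * laplace psi t)| <=
    G * (M * (Gamma b * Gamma (a - b))).
Proof.
move=> b0 ba M0 G0 mphi mpsi hphi hpsi hL; have a0 : 0 < a by lra.
pose phi0 (t : R) := t `^ (a - 1) * expR (- t).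
pose psi0 (s : R) := M * s `^ (b - 1).
have mphi0 : measurable_fun `](0 : R), +oo[ phi0 by exact: measurable_powR_expRN.
have mpsi0 : measurable_fun `](0 : R), +oo[ psi0 by exact: measurable_powR_mul.
have [iK0 I0] := integrable_power_kernel b0 ba M0.
have iK := integrable_laplace_kernel_le mphi mpsi hphi hpsi iK0.
have iphi0 t (t0 : 0 < t) := (laplace_powR_expRN a0 t0).1.
have ipsi0 t (t0 : 0 < t) := (laplace_powR M b0 t0).1.
have iphi t : 0 < t -> (@lebesgue_measure R).-integrable `](0 : R), +oo[
    (EFin \o (fun s => phi s * expR (- (t * s)))).
  move=> t0; apply: le_integrable (iphi0 t t0) => //.
    by apply/measurable_EFinP; exact: measurable_laplace_integrand.
  move=> s; rewrite /= in_itv/= andbT => s0; rewrite lee_fin normrM [leRHS]normrM ler_wpM2r//.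
  by rewrite (le_trans (hphi s s0))// ler_norm.
have ipsi t : 0 < t -> (@lebesgue_measure R).-integrable `](0 : R), +oo[
    (EFin \o (fun s => psi s * expR (- (t * s)))).
  move=> t0; apply: le_integrable (ipsi0 t t0) => //.
    by apply/measurable_EFinP; exact: measurable_laplace_integrand.
  move=> s; rewrite /= in_itv/= andbT => s0; rewrite lee_fin normrM [leRHS]normrM ler_wpM2r//.
  by rewrite (le_trans (hpsi s s0))// ler_norm.
have [i1 _ E] := Laplace_sym mphi mpsi ipsi iphi iK.
have [i2 _ _] := Laplace_sym mpsi mphi iphi ipsi (integrable_laplace_kernelC mphi mpsi iK).
have [_ _ E0] := Laplace_sym mphi0 mpsi0 ipsi0 iphi0 iK0.
have [i0 _ _] := Laplace_sym mpsi0 mphi0 iphi0 ipsi0 (integrable_laplace_kernelC mphi0 mpsi0 iK0).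
split; first exact: i1.
rewrite E; apply: le_trans (le_normr_Rintegral (measurable_itvR _) i2) _.
(* The bounding integral of s ^ (b - 1) (1 + s) ^ (- a) is the [s] side of the model pair, so
   symmetry read backwards evaluates it from [I0]. *)
rewrite -I0 E0 -RintegralZl; [|exact: measurable_itvR|exact: i0].
apply: le_Rintegral.
- exact: measurable_itvR.
- exact: integrable_norm i2.
- exact: (integrableZl (measurable_itvR _) G i0).
- move=> s; rewrite /= in_itv/= andbT => s0.
  rewrite normrM mulrCA (laplace_powR_expRN a0 s0).2.
  exact: ler_pM (hpsi s s0) (hL s s0).
Qed.

End PowerKernel.

(** * Oscillating integrals bounded by the modulus of Gamma *)

Section ComplexGamma.
Local Open Scope classical_set_scope.
Local Open Scope complex_scope.

(** Cauchy-Schwarz against a unit vector; the difference of the squares is (cos th * v - sin th * u)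
    ^ 2. *)
Lemma normr_trig_comb_le (R : realType) (th u v : R) :
  `|cos th * u + sin th * v| <= Num.sqrt (u ^+ 2 + v ^+ 2).
Proof.
rewrite -sqrtr_sqr ler_wsqrtr//; have := cos2Dsin2 th.
move: (cos th) (sin th) => c s cs; have := sqr_ge0 (c * v - s * u).
have -> : u ^+ 2 + v ^+ 2 = (c ^+ 2 + s ^+ 2) * (u ^+ 2 + v ^+ 2) by rewrite cs mul1r.
by lra.
Qed.

Lemma measurable_osc (R : realType) (g : R -> R) (a tau th : R) (D : set R) :
  continuous g ->
  measurable_fun D (fun t : R => t `^ (a - 1) * expR (- t) * g (tau * ln t + th)).
Proof.
move=> cg; apply: measurable_funTS; apply: measurable_funM.
  exact: measurable_powR_expRN.
have ml : measurable_fun [set: R] (fun t : R => tau * ln t + th).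
  apply: measurable_funD => //; apply: measurable_funM => //; exact: measurable_ln.
exact: (measurableT_comp (continuous_measurable_fun cg) ml).
Qed.

Lemma integrable_osc (R : realType) (g : R -> R) (a tau th : R) : 0 < a ->
  continuous g -> (forall u, `|g u| <= 1) ->
  (@lebesgue_measure R).-integrable `](0 : R), +oo[
    (EFin \o (fun t => t `^ (a - 1) * expR (- t) * g (tau * ln t + th))).
Proof.
move=> a0 cg g1; apply: le_integrable (integrable_powR_expRN a0) => //.
  by apply/measurable_EFinP; exact: measurable_osc.
by move=> t _; rewrite lee_fin normrM ler_piMr.
Qed.

Lemma normr_sin_le1 (R : realType) (u : R) : `|sin u| <= 1.
Proof. by rewrite ler_norml sin_geN1 sin_le1. Qed.

Lemma normr_cos_le1 (R : realType) (u : R) : `|cos u| <= 1.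
Proof. by rewrite ler_norml cos_geN1 cos_le1. Qed.

(** By the addition formula the integral is the component of the vector (Re Gamma, Im Gamma) in a
    direction fixed by [th], so its size is at most the modulus for every phase. *)
Lemma normr_integral_osc_le (R : realType) (a tau th : R) : 0 < a ->
  `|\int[@lebesgue_measure R]_(t in `]0, +oo[)
     (t `^ (a - 1) * expR (- t) * sin (tau * ln t + th))|
  <= Normc.normc (GammaC (a +i* tau)).
Proof.
move=> a0.
pose C := \int[@lebesgue_measure R]_(t in `]0, +oo[)
  (t `^ (a - 1) * expR (- t) * cos (tau * ln t + 0)).
pose S := \int[@lebesgue_measure R]_(t in `]0, +oo[)
  (t `^ (a - 1) * expR (- t) * sin (tau * ln t + 0)).
have iC := integrable_osc tau 0 a0 (@continuous_cos R) (@normr_cos_le1 R).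
have iS := integrable_osc tau 0 a0 (@continuous_sin R) (@normr_sin_le1 R).
have -> : GammaC (a +i* tau) = C +i* S.
  rewrite /GammaC /cpow /=; congr (_ +i* _); apply: eq_Rintegral => t _.
    by rewrite oppr0 !addr0 mulr0 subr0 mulrAC.
  by rewrite oppr0 !addr0 mulr0 add0r mulrAC.
rewrite /Normc.normc.
have -> : \int[@lebesgue_measure R]_(t in `]0, +oo[)
    (t `^ (a - 1) * expR (- t) * sin (tau * ln t + th)) = cos th * S + sin th * C.
  rewrite /S /C -RintegralZl; [|exact: measurable_itvR|exact: iS].
  rewrite -RintegralZl; [|exact: measurable_itvR|exact: iC].
  have jS := integrableZl (measurable_itvR _) (cos th) iS.
  have jC := integrableZl (measurable_itvR _) (sin th) iC.
  rewrite -RintegralD; [|exact: measurable_itvR|exact: jS|exact: jC].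
  by apply: eq_Rintegral => t _; rewrite addr0 sinD; ring.
by rewrite [C ^+ 2 + _]addrC; exact: normr_trig_comb_le.
Qed.

(** Rescaling [t] by 1 + s turns exp (- t - s t) into exp (- t). It costs the factor (1 + s) ^ (- a)
    and the phase shift tau ln (1 + s), which [th'] absorbs. *)
Lemma normr_laplace_osc_le (R : realType) (a tau th s : R) : 0 < a -> 0 < s ->
  `|laplace (fun t => t `^ (a - 1) * expR (- t) * sin (tau * ln t + th)) s|
  <= Normc.normc (GammaC (a +i* tau)) * (1 + s) `^ (- a).
Proof.
move=> a0 s0; have c0 : 0 < 1 + s by lra.
have ca : 0 < (1 + s) `^ a by exact: powR_gt0.
rewrite powRN ler_pdivlMr// -[X in _ * X <= _](gtr0_norm ca) -normrM mulrC.
pose th' := th - tau * ln (1 + s).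
have i0 := integrable_osc tau th' a0 (@continuous_sin R) (@normr_sin_le1 R).
apply: le_trans (normr_integral_osc_le tau th' a0).
rewrite -(Rintegral_scale c0 i0) -(mulr_powRB1 (ltW c0) a0) -mulrA.
rewrite /laplace.
have -> : \int[@lebesgue_measure R]_(x in `]0, +oo[)
    (((1 + s) * x) `^ (a - 1) * expR (- ((1 + s) * x)) * sin (tau * ln ((1 + s) * x) + th')) =
    (1 + s) `^ (a - 1) * \int[@lebesgue_measure R]_(t in `]0, +oo[)
      (t `^ (a - 1) * expR (- t) * sin (tau * ln t + th) * expR (- (s * t))).
  rewrite -RintegralZl; last 2 first.
  - exact: measurable_itvR.
  - apply: le_integrable (laplace_powR_expRN a0 s0).1 => //.
      apply/measurable_EFinP; apply: measurable_laplace_integrand.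
      by apply: measurable_osc; exact: continuous_sin.
    by move=> t _; rewrite lee_fin mulrAC normrM ler_piMr// normr_sin_le1.
  apply: eq_Rintegral => t; rewrite inE/= in_itv/= andbT => t0.
  rewrite powRM ?(ltW t0) ?(ltW c0)// lnM ?posrE// (_ : - ((1 + s) * t) = - t + - (s * t)); last by ring.
  rewrite expRD (_ : tau * _ + th' = tau * ln t + th); last by rewrite /th'; ring.
  by ring.
by [].
Qed.

End ComplexGamma.

(** * Reduction of the pairing to the Macdonald function *)

Section MacdonaldReduction.
Local Open Scope classical_set_scope.

Lemma continuous_itv_integrable (R : realType) (f : R -> R) (a b : R) :
  (forall t, a <= t <= b -> {for t, continuous f}) ->
  (@lebesgue_measure R).-integrable (`[a, b] : set (measurableTypeR R)) (EFin \o f).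
Proof.
move=> cf; apply: continuous_compact_integrable; first exact: segment_compact.
by apply: continuous_in_subspaceT => t; rewrite inE/= in_itv/=; exact: cf.
Qed.

(** Used with [e] equal to 1 and to -1, for the substitutions t = y exp u and t = y exp (- u). *)
Lemma is_derive_mul_expR (R : realType) (y e u : R) :
  is_derive u 1 (fun v : R => y * expR (e * v)) (y * e * expR (e * u)).
Proof.
have d1 := is_deriveM (is_derive_cst e u 1) (is_derive_id u 1).
have d2 := is_derive1_comp (is_derive_expR (e * u)) d1.
apply: (is_derive_eq (is_deriveM (is_derive_cst y u 1) d2)).
by rewrite /GRing.scale /= !mulr1 !mulr0 !addr0; ring.
Qed.

Lemma derive1_mul_expR (R : realType) (y e : R) :
  (fun v : R => y * expR (e * v))^`() = (fun u => y * e * expR (e * u)).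
Proof.
by apply/funext => u; rewrite derive1E; apply: derive_val; exact: is_derive_mul_expR.
Qed.

Lemma continuous_mul_expR (R : realType) (y e : R) : continuous (fun v : R => y * expR (e * v)).
Proof. by move=> u; exact: is_derive_continuous (is_derive_mul_expR y e u). Qed.

Lemma Rintegral_expR_increasing (R : realType) (y n : R) (q : R -> R) : 0 < y -> 0 <= n ->
  (forall t, 0 < t -> {for t, continuous q}) ->
  \int[@lebesgue_measure R]_(t in `[y, y * expR n]) q t =
  \int[@lebesgue_measure R]_(u in `[0, n]) (q (y * expR u) * (y * expR u)).
Proof.
move=> y0 n0 cq; pose F (v : R) := y * expR (1 * v).
have F0 : F 0 = y by rewrite /F mulr0 expR0 mulr1.
have Fn : F n = y * expR n by rewrite /F mul1r.
have cF' : continuous F^`().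
  by rewrite /F derive1_mul_expR; exact: continuous_mul_expR.
rewrite /Rintegral -{1}F0 -Fn integration_by_substitution_increasing//.
- congr fine; apply: eq_integral => u _; rewrite /F derive1_mul_expR !fctE /=.
  by rewrite mulr1 !mul1r.
- by move=> u v _ _ uv; rewrite /F ltr_pM2l// ltr_expR !mul1r.
- apply/cvg_ex; exists (F^`() 0); apply: cvg_at_right_filter; exact: cF'.
- apply/cvg_ex; exists (F^`() n); apply: cvg_at_left_filter; exact: cF'.
- split.
  + by move=> u _; apply: ex_derive; exact: is_derive_mul_expR.
  + by apply: cvg_at_right_filter; exact: continuous_mul_expR.
  + by apply: cvg_at_left_filter; exact: continuous_mul_expR.
- apply: continuous_in_subspaceT => t; rewrite inE/= in_itv/= F0 => /andP[yt _].
  by apply: cq; exact: lt_le_trans yt.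
Qed.

Lemma Rintegral_expR_decreasing (R : realType) (y n : R) (q : R -> R) : 0 < y -> 0 <= n ->
  (forall t, 0 < t -> {for t, continuous q}) ->
  \int[@lebesgue_measure R]_(t in `[y * expR (- n), y]) q t =
  \int[@lebesgue_measure R]_(u in `[0, n]) (q (y * expR (- u)) * (y * expR (- u))).
Proof.
move=> y0 n0 cq; pose F (v : R) := y * expR (-1 * v).
have F0 : F 0 = y by rewrite /F mulr0 expR0 mulr1.
have Fn : F n = y * expR (- n) by rewrite /F mulN1r.
have cF' : continuous F^`().
  by rewrite /F derive1_mul_expR; exact: continuous_mul_expR.
rewrite /Rintegral -{2}F0 -Fn integration_by_substitution_decreasing//.
- congr fine; apply: eq_integral => u _; rewrite /F derive1_mul_expR !fctE /=.
  by rewrite !mulN1r mulrN1 mulNr opprK.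
- by move=> u v _ _ uv; rewrite /F ltr_pM2l// ltr_expR !mulN1r ltrN2.
- apply/cvg_ex; exists (F^`() 0); apply: cvg_at_right_filter; exact: cF'.
- apply/cvg_ex; exists (F^`() n); apply: cvg_at_left_filter; exact: cF'.
- split.
  + by move=> u _; apply: ex_derive; exact: is_derive_mul_expR.
  + by apply: cvg_at_right_filter; exact: continuous_mul_expR.
  + by apply: cvg_at_left_filter; exact: continuous_mul_expR.
- apply: continuous_in_subspaceT => t; rewrite inE/= in_itv/= Fn => /andP[yt _].
  by apply: cq; apply: lt_le_trans yt; rewrite mulr_gt0 ?expR_gt0.
Qed.

(** The interval is cut at [y], with t = y exp u above it and t = y exp (- u) below. This folds the
    real line in u onto the half-line over which [macdonaldK_im] integrates. *)
Lemma Rintegral_expR_fold (R : realType) (y n : R) (q : R -> R) : 0 < y -> 0 <= n ->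
  (forall t, 0 < t -> {for t, continuous q}) ->
  \int[@lebesgue_measure R]_(t in `[y * expR (- n), y * expR n]) q t =
  \int[@lebesgue_measure R]_(u in `[0, n])
    (q (y * expR u) * (y * expR u) + q (y * expR (- u)) * (y * expR (- u))).
Proof.
move=> y0 n0 cq.
have yn : y <= y * expR n by rewrite ler_peMr ?(ltW y0)// -expR0 ler_expR.
have yN : y * expR (- n) <= y by rewrite ler_piMr ?(ltW y0)// -expR0 ler_expR oppr_le0.
have p t : y * expR (- n) <= t -> 0 < t by apply: lt_le_trans; rewrite mulr_gt0 ?expR_gt0.
have iq : (@lebesgue_measure R).-integrable
    (`[y * expR (- n), y * expR n] : set (measurableTypeR R)) (EFin \o q).
  by apply: continuous_itv_integrable => t /andP[/p t0 _]; exact: cq.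
have cqe (e : R) : continuous (fun u : R => q (y * expR (e * u)) * (y * expR (e * u))).
  move=> u; apply: cvgM; last exact: continuous_mul_expR.
  apply: (@continuous_comp _ _ _ (fun u : R => y * expR (e * u)) q); first exact: continuous_mul_expR.
  by apply: cq; rewrite mulr_gt0 ?expR_gt0.
have ie (e : R) : (@lebesgue_measure R).-integrable (`[0, n] : set (measurableTypeR R))
    (EFin \o (fun u : R => q (y * expR (e * u)) * (y * expR (e * u)))).
  by apply: continuous_itv_integrable => t _; exact: cqe.
have i1 := ie 1; have i2 := ie (-1).
rewrite (_ : (fun u => _) = (fun u => q (y * expR u) * (y * expR u))) in i1; last first.
  by apply/funext => u; rewrite mul1r.
rewrite (_ : (fun u => _) = (fun u => q (y * expR (- u)) * (y * expR (- u)))) in i2; last first.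
  by apply/funext => u; rewrite mulN1r.
rewrite RintegralD; [|exact: measurable_itvR|exact: i1|exact: i2].
rewrite -Rintegral_expR_increasing// -Rintegral_expR_decreasing//.
have := @Rintegral_itvB R q (BLeft (y * expR (- n))) (BRight (y * expR n)) y iq.
rewrite !bnd_simp => /(_ yN yn).
rewrite Rintegral_itv_obnd_cbnd; first by move=> <-; rewrite subrK.
apply: integrableS iq => //.
by apply: subset_itvr; rewrite bnd_simp.
Qed.

(** A linear bound is enough: it puts exp (- x cosh u) below exp (- x u / 2) for x > 0, which gives
    both integrability and decay at infinity. *)
Lemma cosh_ge (R : realType) (u : R) : u / 2 <= cosh u.
Proof.
have := expR_ge1Dx u; have := expR_gt0 (- u); rewrite /cosh; lra.
Qed.

Lemma coshN (R : realType) (u : R) : cosh (- u) = cosh u.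
Proof. by rewrite /cosh opprK addrC. Qed.

Lemma is_derive_cosh (R : realType) (u : R) :
  is_derive u 1 (@cosh R) ((expR u - expR (- u)) / 2).
Proof.
have dN := is_derive1_comp (is_derive_expR (- u)) (is_deriveNid u 1).
have d := is_deriveM (is_deriveD (is_derive_expR u) dN) (is_derive_cst (2^-1 : R) u 1).
by apply: (is_derive_eq d); rewrite /GRing.scale /= !fctE /=; ring.
Qed.

Lemma is_derive_expR_cosh (R : realType) (x u : R) :
  is_derive u 1 (fun v => expR (- x * cosh v))
    (expR (- x * cosh u) * (- x * ((expR u - expR (- u)) / 2))).
Proof.
have d : is_derive u 1 (fun v => - x * cosh v) (- x * ((expR u - expR (- u)) / 2)).
  apply: (is_derive_eq (is_deriveM (is_derive_cst (- x) u 1) (is_derive_cosh u))).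
  by rewrite /GRing.scale /= mulr0 addr0.
exact (@is_derive1_comp R expR (fun v => - x * cosh v) u _ _ (is_derive_expR _) d).
Qed.

Lemma is_derive_trig_mul (R : realType) (tau u : R) :
  is_derive u 1 (fun v : R => sin (tau * v)) (tau * cos (tau * u)) /\
  is_derive u 1 (fun v : R => cos (tau * v)) (- (tau * sin (tau * u))).
Proof.
have d := is_deriveM (is_derive_cst tau u 1) (is_derive_id u 1).
split.
  apply: (is_derive_eq (is_derive1_comp (is_derive_sin (tau * u)) d)).
  by rewrite /GRing.scale /= mulr1 mulr0 addr0 mulrC.
apply: (is_derive_eq (is_derive1_comp (is_derive_cos (tau * u)) d)).
by rewrite /GRing.scale /= mulr1 mulr0 addr0 mulrC mulrN.
Qed.

Lemma macdonaldK_im_pos (R : realType) (tau x : R) : 0 < x ->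
  (@lebesgue_measure R).-integrable `](0 : R), +oo[
    (EFin \o (fun u => expR (- x * cosh u) * cos (tau * u))) /\
  macdonaldK_im tau x =
    \int[@lebesgue_measure R]_(u in `]0, +oo[) (expR (- x * cosh u) * cos (tau * u)).
Proof.
move=> x0; have x2 : 0 < x / 2 by rewrite divr_gt0.
have mk : measurable_fun `](0 : R), +oo[ (fun u => expR (- x * cosh u) * cos (tau * u)).
  apply: measurable_funTS; apply: measurable_funM; apply: continuous_measurable_fun => u.
    exact: is_derive_continuous (is_derive_expR_cosh x u).
  exact: is_derive_continuous (is_derive_trig_mul tau u).2.
have ik : (@lebesgue_measure R).-integrable `](0 : R), +oo[
    (EFin \o (fun u => expR (- x * cosh u) * cos (tau * u))).
  (* The dominating function is exp (- x u / 2), written as a Gamma integrand of exponent 1. *)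
  apply: le_integrable (integrable_powR_expR ltr01 x2) => //; first exact/measurable_EFinP.
  move=> u; rewrite /= in_itv/= andbT => u0; rewrite lee_fin subrr powRr0 mul1r normrM.
  apply: le_trans (ler_piMr _ (normr_cos_le1 _)) _ => //.
  rewrite !ger0_norm ?expR_ge0// ler_expR.
  by have := ler_wpM2l (ltW x0) (cosh_ge u); lra.
split => //; rewrite /macdonaldK_im.
by rewrite -Rintegral_itv_obnd_cbnd.
Qed.

(* Up to a constant, q is the integrand of K_(1 - i tau) - K_(1 + i tau), and
   the left-hand side is q t dt for t = y * expR u. *)
Lemma osc_expR (R : realType) (x tau u : R) : 0 < x ->
  let y := x / 2 in
  let q t := t ^- 2 * expR (- t - y ^+ 2 / t) * sin (tau * ln t - tau * ln y) in
  q (y * expR u) * (y * expR u) =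
    y^-1 * expR (- u) * expR (- x * cosh u) * sin (tau * u).
Proof.
move=> x0 y q; have y0 : 0 < y by rewrite divr_gt0.
have e0 := expR_gt0 u; have yn := lt0r_neq0 y0; have en := lt0r_neq0 e0.
rewrite /q lnM ?posrE// expRK (_ : tau * (ln y + u) - tau * ln y = tau * u); last by ring.
rewrite (_ : - (y * expR u) - y ^+ 2 / (y * expR u) = - x * cosh u); last first.
  rewrite /cosh expRN (_ : x = 2 * y); last by rewrite /y; field.
  by field; rewrite en yn.
rewrite expRN; move: (expR (- x * _)) (sin _) => H S.
by field; rewrite yn en.
Qed.

(** Folding replaces exp (- u) by exp (- u) - exp u because the sine is odd. The resulting integrand
    plus tau times that of [macdonaldK_im] is the derivative of [P], which vanishes at 0 and at
    infinity. *)
Lemma Rintegral_osc_macdonaldK (R : realType) (x tau : R) : 0 < x ->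
  let y := x / 2 in
  let q t := t ^- 2 * expR (- t - y ^+ 2 / t) * sin (tau * ln t - tau * ln y) in
  (@lebesgue_measure R).-integrable `](0 : R), +oo[ (EFin \o q) ->
  x ^+ 2 / 4 * \int[@lebesgue_measure R]_(t in `]0, +oo[) q t
  = - (tau * macdonaldK_im tau x).
Proof.
move=> x0 y q iq; have y0 : 0 < y by rewrite divr_gt0.
have [ik ->] := macdonaldK_im_pos tau x0.
pose k (u : R) := expR (- x * cosh u) * cos (tau * u).
pose r (u : R) := q (y * expR u) * (y * expR u) + q (y * expR (- u)) * (y * expR (- u)).
pose P (u : R) := expR (- x * cosh u) * sin (tau * u).
have cE : continuous (fun u : R => expR (- x * cosh u)).
  by move=> u; exact: is_derive_continuous (is_derive_expR_cosh x u).
have ck : continuous k.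
  move=> u; apply: cvgM; first exact: cE.
  exact: is_derive_continuous (is_derive_trig_mul tau u).2.
have rE u : r u = y^-1 * (expR (- u) - expR u) * P u.
  rewrite /r osc_expR// osc_expR// coshN opprK mulrN sinN /P; ring.
have cP : continuous P.
  move=> u; apply: cvgM; first exact: cE.
  exact: is_derive_continuous (is_derive_trig_mul tau u).1.
have cr : continuous r.
  have -> : r = (fun u => y^-1 * (expR (- u) - expR u) * P u) by apply/funext.
  move=> u; apply: cvgM; last exact: cP.
  apply: cvgM; first exact: cvg_cst.
  apply: cvgB; last exact: continuous_expR.
  exact: is_derive_continuous (is_derive1_comp (is_derive_expR (- u)) (is_deriveNid u 1)).
(* Since x ^ 2 / 4 = y ^ 2 and x = 2 y, the term x ^ 2 / 4 * r u is - x sinh u * P u, the part of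
   the derivative that comes from exp (- x cosh u). *)
have dP (u : R) : is_derive u 1 P (x ^+ 2 / 4 * r u + tau * k u).
  have := is_deriveM (is_derive_expR_cosh x u) (is_derive_trig_mul tau u).1.
  move=> d; apply: (is_derive_eq d); rewrite rE /P /k /GRing.scale /= /y.
  by field; rewrite gt_eqF.
have cq (t : R) : 0 < t -> {for t, continuous q}.
  move=> t0; have tn := lt0r_neq0 t0; have tn2 : t ^+ 2 != 0 by rewrite expf_neq0.
  have d1 := @is_deriveV R (fun t => t ^+ 2) t _ 1 tn2 (is_deriveX 2 (is_derive_id t 1)).
  have dV := @is_deriveV R id t _ 1 tn (is_derive_id t 1).
  have d2 := @is_derive1_comp R expR (fun t => - t - y ^+ 2 / t) t _ _ (is_derive_expR _)
    (is_deriveB (is_deriveNid t 1) (is_deriveM (is_derive_cst (y ^+ 2) t 1) dV)).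
  have d3 := @is_derive1_comp R (@sin R) (fun t => tau * ln t - tau * ln y) t _ _ (is_derive_sin _)
    (is_deriveB (is_deriveM (is_derive_cst tau t 1) (is_derive1_ln t0)) (is_derive_cst (tau * ln y) t 1)).
  exact (is_derive_continuous (is_deriveM (is_deriveM d1 d2) d3)).
have cp : continuous (fun u => x ^+ 2 / 4 * r u + tau * k u).
  move=> u; apply: cvgD; apply: cvgM; try exact: cvg_cst; first exact: cr.
  exact: ck.
have S n : x ^+ 2 / 4 * \int[@lebesgue_measure R]_(t in `[y * expR (- n.+1%:R), y * expR n.+1%:R]) q t
    = P n.+1%:R - tau * \int[@lebesgue_measure R]_(u in `[0, n.+1%:R]) k u.
  have n0 : 0 < n.+1%:R :> R by [].
  rewrite Rintegral_expR_fold ?(ltW n0)// -/(r _).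
  have ir := continuous_itv_integrable (a := 0) (b := n.+1%:R) (fun t _ => cr t).
  have ikn := continuous_itv_integrable (a := 0) (b := n.+1%:R) (fun t _ => ck t).
  have ir' := integrableZl (measurable_itvR _) (x ^+ 2 / 4) ir.
  have ik' := integrableZl (measurable_itvR _) tau ikn.
  have : \int[@lebesgue_measure R]_(u in `[0, n.+1%:R]) (x ^+ 2 / 4 * r u + tau * k u) = P n.+1%:R - P 0.
    by rewrite /Rintegral (is_derive_FTC2 n0 (fun t _ => dP t) (fun t _ => cp t)).
  rewrite RintegralD; [|exact: measurable_itvR|exact: ir'|exact: ik'].
  rewrite RintegralZl; [|exact: measurable_itvR|exact: ir].
  rewrite RintegralZl; [|exact: measurable_itvR|exact: ikn].
  rewrite [P 0](_ : _ = 0) ?subr0; last by rewrite /P mulr0 sin0 mulr0.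
  by move=> <-; rewrite addrK.
have cQ : (fun n => \int[@lebesgue_measure R]_(t in `[y * expR (- n.+1%:R), y * expR n.+1%:R]) q t)
    @ \oo --> \int[@lebesgue_measure R]_(t in `]0, +oo[) q t.
  apply: cvg_Rintegral_itv_pos iq.
  - by move=> n; rewrite mulr_gt0 ?expR_gt0.
  - apply: (@squeeze_cvgr _ _ _ _ (cst 0) (fun n => y * harmonic n)).
    + apply: nearW => n; rewrite mulr_ge0 ?expR_ge0 ?(ltW y0)//=.
      rewrite ler_wpM2l ?(ltW y0)// expRN /harmonic lef_pV2 ?posrE ?expR_gt0//.
      by apply: le_trans (expR_ge1Dx _); rewrite lerDr.
    + exact: cvg_cst.
    + by rewrite -[X in _ --> X](mulr0 y); apply: cvgM; [exact: cvg_cst|exact: cvg_harmonic].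
  - apply/cvgryPge => A; move/cvgryPge : (@cvg_natrS2y R) => /(_ (A / y)).
    apply: filterS => n; rewrite ler_pdivrMr// mulrC => /le_trans; apply.
    rewrite ler_wpM2l ?(ltW y0)//; apply: le_trans (expR_ge1Dx _).
    by rewrite -[n.+2%:R]nat1r.
have cK : (fun n => \int[@lebesgue_measure R]_(u in `[0, n.+1%:R]) k u)
    @ \oo --> \int[@lebesgue_measure R]_(u in `]0, +oo[) k u.
  rewrite (_ : (fun n => _) = (fun n => \int[@lebesgue_measure R]_(u in `]0, n.+1%:R]) k u)); last first.
    apply/funext => n; rewrite Rintegral_itv_obnd_cbnd//; apply: integrableS ik => //.
    by move=> u; rewrite /= !in_itv/= andbT => /andP[].
  apply: (@cvg_Rintegral_subset R `](0 : R), +oo[ (fun n => `](0 : R), n.+1%:R]) k _ _ _ _ ik).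
  - exact: measurable_itvR.
  - by move=> n; exact: measurable_itvR.
  - by move=> n u; rewrite /= !in_itv/= andbT => /andP[].
  - move=> u; rewrite /= in_itv/= andbT => u0.
    exists (Num.bound u) => // n /= hn; rewrite in_itv/= u0/=.
    apply: le_trans (ltW (archi_boundP (ltW u0))) _.
    by rewrite ler_nat (leq_trans hn).
have cP0 : (fun n => P n.+1%:R) @ \oo --> 0.
  (* Here [cosh_ge] is combined with exp (- v) <= 1 / v for v = x (n + 1) / 2. *)
  have Pn n : `|P n.+1%:R| <= 2 / x * harmonic n.
    have n0 : 0 < n.+1%:R :> R by [].
    have xn : 0 < x / 2 * n.+1%:R by rewrite mulr_gt0// divr_gt0.
    rewrite normrM; apply: le_trans (ler_piMr _ (normr_sin_le1 _)) _ => //.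
    rewrite ger0_norm ?expR_ge0//; apply: (@le_trans _ _ (expR (- (x / 2 * n.+1%:R)))).
      by rewrite ler_expR; have := ler_wpM2l (ltW x0) (cosh_ge n.+1%:R); lra.
    rewrite (_ : 2 / x * harmonic n = (x / 2 * n.+1%:R)^-1); last by rewrite invfM invf_div.
    rewrite expRN lef_pV2 ?posrE ?expR_gt0//.
    by apply: le_trans (expR_ge1Dx _); rewrite lerDr.
  have ch : (fun n => 2 / x * harmonic n) @ \oo --> 0.
    by rewrite -[X in _ --> X](mulr0 (2 / x)); apply: cvgM; [exact: cvg_cst|exact: cvg_harmonic].
  apply: (@squeeze_cvgr _ _ _ _ (fun n => - (2 / x * harmonic n)) (fun n => 2 / x * harmonic n)) => //.
  - by apply: nearW => n; rewrite -ler_norml.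
  - by rewrite -[X in _ --> X]oppr0; exact: cvgN.
have L1 : (fun n => x ^+ 2 / 4 * \int[@lebesgue_measure R]_(t in `[y * expR (- n.+1%:R), y * expR n.+1%:R]) q t)
    @ \oo --> x ^+ 2 / 4 * \int[@lebesgue_measure R]_(t in `]0, +oo[) q t.
  by apply: cvgM; [exact: cvg_cst|exact: cQ].
have L2 : (fun n => P n.+1%:R - tau * \int[@lebesgue_measure R]_(u in `[0, n.+1%:R]) k u)
    @ \oo --> - (tau * \int[@lebesgue_measure R]_(u in `]0, +oo[) k u).
  rewrite -[X in _ --> X]add0r; apply: cvgB; first exact: cP0.
  by apply: cvgM; [exact: cvg_cst|exact: cK].
move: L1; under eq_fun do rewrite S.
by move=> L1; have := cvg_unique _ L1 L2 => /(_ (@Rhausdorff _) _).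
Qed.

End MacdonaldReduction.

(** * Power bound for psi and collection of the constants *)

Section Assembly.
Local Open Scope classical_set_scope.

(** The supremum bound at x sqrt s is divided by the square root of x sqrt s, that is x ^ (1 / 2) s
    ^ (1 / 4). The exponent of [s] is written as b - 1 to fit [laplace_pairing_le]. *)
Lemma besselJ_sqrt_le (R : realType) (nu x s : R) : 1 / 2 <= nu -> 0 < x -> 0 < s ->
  `|besselJ nu (x * Num.sqrt s) * s `^ (nu / 2)| <=
  besselJ_const nu * x `^ (- (1 / 2)) * s `^ (nu / 2 + 3 / 4 - 1).
Proof.
move=> nu12 x0 s0; have sq0 : 0 < Num.sqrt s by rewrite sqrtr_gt0.
have xs0 : 0 < x * Num.sqrt s by rewrite mulr_gt0.
rewrite normrM (ger0_norm (powR_ge0 _ _)).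
rewrite (_ : nu / 2 + 3 / 4 - 1 = nu / 2 + - (1 / 4)); last by lra.
rewrite (@powRD _ s (nu / 2) (- (1 / 4))); last by rewrite (gt_eqF s0) implybT.
have := sqrt_besselJ_le_const nu12 (ltW xs0).
have -> : Num.sqrt (x * Num.sqrt s) = x `^ (1 / 2) * s `^ (1 / 4).
  rewrite sqrtrM ?(ltW x0)// -(powR12_sqrt (ltW x0)) -(powR12_sqrt (sqrtr_ge0 s)).
  rewrite -(powR12_sqrt (ltW s0)) -powRrM.
  by congr (_ `^ _ * _ `^ _); lra.
have p1 : 0 < x `^ (1 / 2) by exact: powR_gt0.
have p2 : 0 < s `^ (1 / 4) by exact: powR_gt0.
have := powR_ge0 s (nu / 2).
rewrite !powRN; move: (x `^ (1 / 2)) (s `^ (1 / 4)) (s `^ (nu / 2)) p1 p2 => X S p X0 S0 p0 h.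
rewrite mulrC (_ : besselJ_const nu / X * (p / S) = p * (besselJ_const nu / (X * S))); last first.
  by field; rewrite !gt_eqF.
by rewrite ler_wpM2l// ler_pdivlMr ?mulr_gt0// mulrC.
Qed.

End Assembly.

Local Open Scope complex_scope.

Theorem mainTheorem9 (R : realType) (nu : R) (hnu : 3 / 2 < nu)
    (x tau : R) (hx : 0 < x) (htau : 0 < tau) :
  `|macdonaldK_im tau x| <=
    2 `^ (nu - 2) * besselJ_const nu
    * (Gamma ((nu + 3 / 2) / 2) * Gamma ((nu - 3 / 2) / 2) / (tau * Gamma nu))
    * Normc.normc (GammaC (nu +i* tau))
    * x `^ (3 / 2 - nu).
Proof.
have nu0 : 0 < nu by lra.
have nu12 : 1 / 2 <= nu by lra.
have g0 := Gamma_gt0 nu0.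
pose th := - (tau * ln (x / 2)).
pose phi (t : R) := t `^ (nu - 1) * expR (- t) * sin (tau * ln t + th).
pose psi (s : R) := besselJ nu (x * Num.sqrt s) * s `^ (nu / 2).
(* For this [b], the condition [b < nu] is equivalent to [3 / 2 < nu]. *)
pose b := nu / 2 + 3 / 4.
pose N := Normc.normc (GammaC (nu +i* tau)).
pose c := besselJ_const nu.
have N0 : 0 <= N by exact: sqrtr_ge0.
have c0 : 0 <= c.
  by apply: le_trans (sqrt_besselJ_le_const nu12 ler01); rewrite mulr_ge0 ?sqrtr_ge0.
have weber t (t0 : 0 < t) := besselJ_Laplace (ltW nu0) hx t0.
have mphi : measurable_fun `](0 : R), +oo[%classic phi.
  by apply: measurable_osc; exact: continuous_sin.
have mpsi : measurable_fun `](0 : R), +oo[%classic psi.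
  have [/measurable_int/measurable_EFinP m1 _] := weber 1 ltr01.
  (* Measurability of [psi] is read off from Weber's integrand at t = 1 by undoing the factor exp (-
     s). *)
  have -> : psi = (fun s => psi s * expR (- (1 * s)) * expR (- (-1 * s))).
    by apply/funext => s; rewrite -mulrA -expRD !mulNr opprK addNr expR0 mulr1.
  exact: measurable_laplace_integrand.
have hphi (t : R) : 0 < t -> `|phi t| <= t `^ (nu - 1) * expR (- t).
  move=> t0; rewrite normrM ger0_norm ?mulr_ge0 ?powR_ge0 ?expR_ge0//.
  by rewrite ler_piMr ?normr_sin_le1// mulr_ge0 ?powR_ge0 ?expR_ge0.
have hpsi (s : R) : 0 < s -> `|psi s| <= c * x `^ (- (1 / 2)) * s `^ (b - 1).
  by move=> s0; exact: besselJ_sqrt_le.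
(* Gamma nu * (1 + s) ^ (- nu) is the transform of the model function t ^ (nu - 1) exp (- t);
   dividing [N] by [Gamma nu] is the source of the denominator in the theorem. *)
have hL (s : R) : 0 < s -> `|laplace phi s| <= N / Gamma nu * (Gamma nu * (1 + s) `^ (- nu)).
  by move=> s0; rewrite mulrA divfK ?gt_eqF//; exact: normr_laplace_osc_le.
have b0 : 0 < b by rewrite /b; lra.
have bnu : b < nu by rewrite /b; lra.
have M0 : 0 <= c * x `^ (- (1 / 2)) by rewrite mulr_ge0 ?powR_ge0.
have G0 : 0 <= N / Gamma nu by rewrite divr_ge0 ?(ltW g0).
have [iA hA] := laplace_pairing_le b0 bnu M0 G0 mphi mpsi hphi hpsi hL.
pose y := x / 2; pose q (t : R) := t ^- 2 * expR (- t - y ^+ 2 / t) * sin (tau * ln t - tau * ln y).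
have y0 : 0 < y by rewrite divr_gt0.
have E (t : R) : 0 < t -> phi t * laplace psi t = y `^ nu * q t.
  move=> t0; rewrite /laplace (weber t t0).2 /phi /q /th -/y.
  rewrite expRD (_ : x ^+ 2 / (4 * t) = y ^+ 2 / t); last by rewrite /y; field; rewrite gt_eqF.
  have -> : t ^- 2 = t `^ (nu - 1) * t `^ (- nu - 1).
    rewrite -powRD; last by rewrite (gt_eqF t0) implybT.
    by rewrite -powR_invn ?(ltW t0)//; congr (_ `^ _); ring.
  by ring.
have yn0 : 0 < y `^ nu by exact: powR_gt0.
have iq : (@lebesgue_measure R).-integrable `](0 : R), +oo[%classic (EFin \o q).
  have := integrableZl (measurable_itvR _) (y `^ nu)^-1 iA.
  apply: eq_integrable; first exact: measurable_itvR.
  move=> t; rewrite inE/= in_itv/= andbT => /E ->.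
  by rewrite -EFinM mulKf ?gt_eqF.
have AE : \int[@lebesgue_measure R]_(t in `]0, +oo[%classic) (phi t * laplace psi t) =
    y `^ nu * \int[@lebesgue_measure R]_(t in `]0, +oo[%classic) q t.
  rewrite -RintegralZl; [|exact: measurable_itvR|exact: iq].
  by apply: eq_Rintegral => t; rewrite inE/= in_itv/= andbT => /E.
have hQ : x ^+ 2 / 4 * \int[@lebesgue_measure R]_(t in `]0, +oo[%classic) q t =
    - (tau * macdonaldK_im tau x) by exact: Rintegral_osc_macdonaldK.
have x4 : 0 <= x ^+ 2 / 4 by rewrite divr_ge0 ?sqr_ge0.
move/(congr1 Num.norm) : hQ.
rewrite normrN normrM (ger0_norm x4) [in X in X -> _]normrM (gtr0_norm htau).
move: hA; rewrite AE normrM (gtr0_norm yn0).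
have -> : (nu + 3 / 2) / 2 = b by rewrite /b; lra.
have -> : (nu - 3 / 2) / 2 = nu - b by rewrite /b; lra.
(* The three powers of [x] have separate origins: 2 from the factor x ^ 2 / 4, - 1 / 2 from the
   bound on [psi], and - nu from dividing by y ^ nu. The last one also brings 2 ^ nu, which with the
   1 / 4 makes 2 ^ (nu - 2). *)
have -> : 3 / 2 - nu = 2%:R + - (1 / 2) + - nu by lra.
rewrite (@powRD _ x (2%:R + - (1 / 2)) (- nu)); last by rewrite (gt_eqF hx) implybT.
rewrite (@powRD _ x 2%:R (- (1 / 2))); last by rewrite (gt_eqF hx) implybT.
rewrite powR_mulrn ?(ltW hx)//.
have -> : 2 `^ (nu - 2) = 2 `^ nu / 4.
  have n2 : 2 != 0 :> R by [].
  rewrite (@powRB _ 2 nu 2%:R) ?n2 ?implybT//.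
  by rewrite powR_mulrn//; congr (_ / _); ring.
have -> : x `^ (- nu) = (2 `^ nu * y `^ nu)^-1.
  by rewrite powRN -powRM ?(ltW y0)//; congr (_ `^ _)^-1; rewrite /y; field.
have := @powR_gt0 R 2 nu (ltr0Sn _ _).
rewrite -/c -/N; move: (2 `^ nu) (y `^ nu) yn0 (x `^ (- (1 / 2))) => P Y Y0 X P0.
move: (Gamma b) (Gamma (nu - b)) (Gamma nu) g0 => Gb Gn G g0.
move: (`|\int[_]_(_ in _) _|) (`|macdonaldK_im tau x|) => Q K hQ hK.
have {hK} -> : K = x ^+ 2 / 4 * Q / tau by rewrite hK mulrC mulKf ?gt_eqF.
have -> : P / 4 * c * (Gb * Gn / (tau * G)) * N * (x ^+ 2 * X * (P * Y)^-1) =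
    x ^+ 2 / 4 * (N / G * (c * X * (Gb * Gn)) / Y) / tau.
  by field; rewrite !gt_eqF.
rewrite ler_wpM2r ?invr_ge0 ?(ltW htau)// ler_wpM2l ?divr_ge0 ?sqr_ge0//.
by rewrite ler_pdivlMr// mulrC.
Qed.
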